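(* Let $\nu\in\mathbb R^N$ belong to an alcove $\Delta$. For any $I,J\in\mathcal I_\lambda$ we have $$O_{I,J}\subset O_{J,J}.$$
   Context: Fix positive integers $n,N$ and $\lambda=(\lambda_1,\dots,\lambda_N)\in\mathbb Z_{\ge0}^N$ with $\sum_k\lambda_k=n$. Put $\lambda^{(k)}=\lambda_1+\dots+\lambda_k$, $\lambda^{\{1\}}=\lambda^{(1)}+\dots+\lambda^{(N-1)}$. $\mathcal I_\lambda$ is the set of ordered partitions $I=(I_1,\dots,I_N)$ of $\{1,\dots,n\}$ with $|I_k|=\lambda_k$; write $\bigcup_{j\le k}I_j=\{i^{(k)}_1<\dots<i^{(k)}_{\lambda^{(k)}}\}$. Alcoves are the connected components of the complement in $\mathbb R^N$ of all hyperplanes $\nu_j-\nu_i=m$, $1\le i<j\le N$, $m\in\mathbb Z$. The integer characteristics of an alcove $\Delta$ are $m_{i,j}=\lfloor\nu_j-\nu_i\rfloor$ ($i<j$), for any $\nu\in\Delta$. Trigonometric weight functions: variables $t=(t^{(k)}_a)$, $1\le k\le N-1$, $1\le a\le\lambda^{(k)}$; $z=(z_1,\dots,z_n)$ with $t^{(N)}_a=z_a$; and $h$. $$W^\Delta_I(t,z,h)=(1-h)^{\lambda^{\{1\}}}\operatorname{Sym}_{t^{(1)}}\cdots\operatorname{Sym}_{t^{(N-1)}}\prod_{k=1}^{N-1}\prod_{a=1}^{\lambda^{(k)}}\Big(\prod_{c=1}^{\lambda^{(k+1)}}\psi^\Delta_{I,k,a,c}(t^{(k+1)}_c/t^{(k)}_a)\prod_{b=a+1}^{\lambda^{(k)}}\frac{1-ht^{(k)}_b/t^{(k)}_a}{1-t^{(k)}_b/t^{(k)}_a}\Big),$$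 where $\operatorname{Sym}_{t^{(k)}}$ is the sum over all permutations of $t^{(k)}_1,\dots,t^{(k)}_{\lambda^{(k)}}$, and $\psi^\Delta_{I,k,a,c}(x)$ equals $1-hx$ if $i^{(k+1)}_c<i^{(k)}_a$, equals $x^{-m_{j,k+1}}$ with $j$ defined by $i^{(k)}_a\in I_j$ if $i^{(k+1)}_c=i^{(k)}_a$, and equals $1-x$ if $i^{(k+1)}_c>i^{(k)}_a$. For $J\in\mathcal I_\lambda$, $W^\Delta_I(z_J,z,h)$ is the result of substituting $t^{(k)}_a=z_{j^{(k)}_a}$ in $W^\Delta_I(t,z,h)$, where $\bigcup_{m\le k}J_m=\{j^{(k)}_1<\dots<j^{(k)}_{\lambda^{(k)}}\}$. It is a Laurent polynomial in $z,h$. For $\nu\in\Delta$ put $S_I(z)=\prod_{k=1}^N\prod_{a\in I_k}z_a^{-\nu_k}$ and $\overline W^\Delta_{I,J}(z,h)=W^\Delta_I(z_J,z,h)\cdot S_I(z)$, a finite combination of monomials in $z_1,\dots,z_n$ with real exponents and coefficients in $\mathbb C[h^{\pm1}]$. For such $f$, $\mathcal N(f)\subset\mathbb R^n$ is the convex hull of the set of exponents $(k_1,\dots,k_n)$ of monomials $z_1^{k_1}\cdots z_n^{k_n}$ whose coefficient in $f$ is nonzero ($h$ is treated as part of the coefficients; $\mathcal N(0)=\emptyset$). Finally $O_{I,J}=\mathcal N(\overline W^\Delta_{I,J}(z,h))$. *)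

(* Defs.v *)
From HB Require Import structures.
From mathcomp Require Import all_boot all_order all_algebra all_fingroup.
From mathcomp Require Import complex finmap.
From mathcomp.multinomials Require mpoly monalg.
From mathcomp Require Import all_classical all_reals all_analysis.
(* The notations of these two libraries clash with those of analysis. *)
Import -(notations) mpoly.
Import -(notations) monalg.
Import Order.TTheory GRing.Theory Num.Theory.
Import numFieldNormedType.Exports.

Set Implicit Arguments.
Unset Strict Implicit.
Unset Printing Implicit Defensive.

Local Open Scope classical_set_scope.
Local Open Scope ring_scope.

(* Elements and components are numbered from 0: the ordinal i : 'I_n is the
   element i + 1 of {1, ..., n}, and j : 'I_N is the component j + 1 of an
   N-tuple. Levels k of the sums lambda^(k) and of the variables t^(k) are
   natural numbers and keep their usual numbering 1, ..., N. *)

Section OrderedPartitions.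
Variables (n N : nat) (lam : 'I_N -> nat).

(* lambda^(k) *)
Definition lamsum (k : nat) : nat := (\sum_(j < N | j < k) lam j)%N.

(* lambda^{1} *)
Definition lamtot : nat := (\sum_(1 <= k < N) lamsum k)%N.

(* I_lambda; a block is empty when the corresponding lambda_k is 0. *)
Definition ordered_partitions : {set {ffun 'I_N -> {set 'I_n}}} :=
  [set I : {ffun 'I_N -> {set 'I_n}} |
    [&& [forall k, #|I k| == lam k],
        [forall j, forall k, (j != k) ==> [disjoint I j & I k]] &
        (\bigcup_(k < N) I k)%SET == [set: 'I_n]%SET]]%SET.

Definition union_upto (I : {ffun 'I_N -> {set 'I_n}}) (k : nat) : {set 'I_n} :=
  (\bigcup_(j < N | (j < k)%N) I j)%SET.

(* i^(k)_a: enum lists a set of ordinals in increasing order. Only the values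
   a < lambda^(k) are meaningful; the default value a is arbitrary. *)
Definition elt (I : {ffun 'I_N -> {set 'I_n}}) (k : nat) (a : 'I_n) : 'I_n :=
  nth a (enum (union_upto I k)) a.

(* The j with x \in I j; the default value j0 is arbitrary. *)
Definition block_of (I : {ffun 'I_N -> {set 'I_n}}) (j0 : 'I_N) (x : 'I_n) :
  'I_N := odflt j0 [pick j | x \in I j].

End OrderedPartitions.

Section Alcoves.
Variables (R : realType) (N : nat).

Definition off_walls : set 'rV[R]_N :=
  [set x | forall (i j : 'I_N) (m : int),
     (i < j)%N -> x ord0 j - x ord0 i != m%:~R].

Definition alcove (D : set 'rV[R]_N) : Prop :=
  exists2 x, off_walls x & D = connected_component off_walls x.

Definition int_char (D : set 'rV[R]_N) (i j : 'I_N) : int :=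
  let x := xget 0 D in Num.floor (x ord0 j - x ord0 i).

(* The integer characteristics may be computed at any point of the alcove. *)
Lemma int_charE (D : set 'rV[R]_N) (x : 'rV[R]_N) (i j : 'I_N) :
  alcove D -> D x -> (i < j)%N ->
  int_char D i j = Num.floor (x ord0 j - x ord0 i).
Proof.
move=> [x0 _ DE] Dx ij; rewrite /int_char.
have Dx1 : D (xget 0 D) by apply: (@xgetPex _ 0 D); exists x.
move: (xget 0 D) Dx1 => y Dy.
have cD : connected D by rewrite DE; exact: component_connected.
have Doff : D `<=` off_walls by rewrite DE; exact: connected_component_sub.
pose g (v : 'rV[R]_N) : R := v ord0 j - v ord0 i.
have cg : continuous g.
  move=> v; apply: (@continuousB _ _ _ (fun u : 'rV[R]_N => u ord0 j)
    (fun u : 'rV[R]_N => u ord0 i)); exact: coord_continuous.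
have itvg : is_interval (g @` D).
  apply/connected_intervalP; apply: connected_continuous_connected => //.
  exact: continuous_subspaceT.
have floor_mono (u v : 'rV[R]_N) : D u -> D v ->
    (Num.floor (g u) <= Num.floor (g v))%R.
  move=> Du Dv; rewrite leNgt; apply/negP => lt_vu.
  have : (g @` D) (Num.floor (g u))%:~R.
    apply: (itvg (g v) (g u)); [by exists v|by exists u|].
    by rewrite floor_le ltW // -floor_lt_int.
  by move=> [w Dw gw]; have /eqP := Doff w Dw i j (Num.floor (g u)) ij.
by apply/eqP; rewrite eq_le !floor_mono.
Qed.

End Alcoves.

Section WeightFunctions.
Variables (R : realType) (n N : nat) (lam : 'I_N -> nat) (D : set 'rV[R]_N).
Variable F : fieldType.

(* The variables are t : nat -> 'I_n -> F, with t k a standing for t^(k)_(a+1);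
   only the values a < lambda^(k) are used. *)

(* The sum over the permutations of t^(k)_1, ..., t^(k)_(lambda^(k)). *)
Definition Sym_t (k : nat) (f : (nat -> 'I_n -> F) -> F) (t : nat -> 'I_n -> F) :
    F :=
  \sum_(s : {perm 'I_n} | perm_on [set a : 'I_n | (a < lamsum lam k)%N]%SET s)
     f (fun l => if l == k then t k \o s else t l).

Variables (I : {ffun 'I_N -> {set 'I_n}}) (h : F).

(* For k : 'I_N with 0 < k, seen as a level 1 <= k <= N - 1, the component
   k + 1 of the integer characteristics is the one indexed by the ordinal k. *)
Definition psi (k : 'I_N) (a c : 'I_n) (x : F) : F :=
  let ia := elt I k a in
  let ic := elt I k.+1 c in
  if (ic < ia)%N then 1 - h * x
  else if ic == ia then x ^ (- int_char D (block_of I k ia) k)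
  else 1 - x.

Definition weight_term (t : nat -> 'I_n -> F) : F :=
  \prod_(k < N | (0 < k)%N) \prod_(a < n | (a < lamsum lam k)%N)
    ((\prod_(c < n | (c < lamsum lam k.+1)%N)
        psi k a c (t k.+1 c / t k a)) *
     \prod_(b < n | (a < b < lamsum lam k)%N)
        ((1 - h * (t k b / t k a)) / (1 - t k b / t k a))).

(* W^Delta_I(t, z, h), as a function of values of the variables in a field. *)
Definition weight_fun (t : nat -> 'I_n -> F) (z : 'I_n -> F) : F :=
  (1 - h) ^+ lamtot lam *
  foldr Sym_t weight_term (iota 1 N.-1) (fun k => if k == N then z else t k).

End WeightFunctions.

(* C(h) and C(h)(z_1, ..., z_n) *)
Notation coef_field R := {fraction {poly R[i]}}.
Notation rat_field R n := {fraction (mpoly n (coef_field R))}.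

Section Laurent.
Variables (R : realType) (n : nat).

Definition hvar : rat_field R n :=
  tofrac (mpolyC n (tofrac 'X : coef_field R)).

Definition zvar (a : 'I_n) : rat_field R n :=
  tofrac (@mpolyX n (coef_field R) (mnm1 a)).

(* The rational function given by a Laurent polynomial, the latter seen as a
   finitely supported family of coefficients indexed by exponents. *)
Definition laurent_eval (p : malg 'rV[int]_n (coef_field R)) : rat_field R n :=
  \sum_(e <- monalg.msupp p)
     tofrac (mpolyC n (monalg.mcoeff e p)) *
     \prod_(a < n) zvar a ^ ((e : 'rV[int]_n) ord0 a).

Let shift_mnm (d : nat) (e : 'rV[int]_n) : multinom n :=
  Multinom [tuple absz (e ord0 a + d%:Z) | a < n].

Let shift_poly (d : nat) (p : malg 'rV[int]_n (coef_field R)) :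
    mpoly n (coef_field R) :=
  \sum_(e <- monalg.msupp p) monalg.mcoeff e p *: mpolyX _ (shift_mnm d e).

Let bounded (d : nat) (e : 'rV[int]_n) : Prop :=
  forall a, 0 <= e ord0 a + d%:Z.

Let shift_mnm_inj d e1 e2 : bounded d e1 -> bounded d e2 ->
  shift_mnm d e1 = shift_mnm d e2 -> e1 = e2.
Proof.
move=> b1 b2 eq12; apply/rowP => a.
have : shift_mnm d e1 a = shift_mnm d e2 a by rewrite eq12.
rewrite /shift_mnm !multinomE !tnth_mktuple => /(congr1 Posz).
by rewrite !gez0_abs // => /addIr.
Qed.

Let shift_polyE d p e :
  (forall e', e' \in monalg.msupp p -> bounded d e') -> bounded d e ->
  mpoly.mcoeff (shift_mnm d e) (shift_poly d p) = monalg.mcoeff e p.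
Proof.
move=> bp be; rewrite /shift_poly raddf_sum /=.
have -> : monalg.mcoeff e p =
    \sum_(e' <- monalg.msupp p) monalg.mcoeff e' p * (e' == e)%:R.
  have [ep|ep] := boolP (e \in monalg.msupp p).
    rewrite (big_fsetD1 e) //= eqxx mulr1 big1_seq ?addr0 // => e'.
    by rewrite !inE => /andP[_ /andP[/negPf -> _]]; rewrite mulr0.
  rewrite big1_seq; first by apply/eqP; rewrite mcoeff_eq0.
  move=> e' /andP[_ e'p]; have [ee'|] := eqVneq e' e; last by rewrite mulr0.
  by rewrite -ee' e'p in ep.
apply: eq_big_seq => e' e'p; rewrite mpoly.mcoeffZ mpoly.mcoeffX;
  congr (_ * (nat_of_bool _)%:R).
apply/eqP/eqP => [|-> //]; apply: shift_mnm_inj => //; exact: bp.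
Qed.

Let laurent_eval_shift d p :
  (forall e, e \in monalg.msupp p -> bounded d e) ->
  laurent_eval p * \prod_(a < n) zvar a ^+ d = tofrac (shift_poly d p).
Proof.
move=> bp; rewrite /laurent_eval mulr_suml /shift_poly rmorph_sum /=.
apply: eq_big_seq => e ep; rewrite -mulrA -big_split /=.
rewrite -mul_mpolyC rmorphM /=; congr (_ * _).
rewrite mpolyXE_id rmorph_prod; apply: eq_bigr => a _.
rewrite /= rmorphXn /= multinomE tnth_mktuple.
have zn0 : zvar a != 0.
  by rewrite /zvar tofrac_eq0 -mpoly.msupp_eq0 mpoly.msuppX.
rewrite -/(zvar a) !exprnP -expfzDr //.
by rewrite gez0_abs //; exact: bp.
Qed.

(* Laurent expansions are unique. *)
Lemma laurent_eval_inj : injective laurent_eval.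
Proof.
move=> p q pq.
pose S := (monalg.msupp p `|` monalg.msupp q)%fset.
pose d : nat := \max_(e <- S) \max_(a < n) absz ((e : 'rV[int]_n) ord0 a).
have bS e : e \in S -> bounded d e.
  move=> eS a; rewrite addrC -lerBlDr sub0r.
  apply: (@le_trans _ _ `|e ord0 a|); first by rewrite lerNl lerNnormlW.
  rewrite -abszE lez_nat.
  apply: (@leq_trans (\max_(a < n) absz (e ord0 a))%N); last first.
    by rewrite /d; apply: leq_bigmax_seq.
  exact: (leq_bigmax a).
have bp e : e \in monalg.msupp p -> bounded d e.
  by move=> ep; apply: bS; rewrite in_fsetU ep.
have bq e : e \in monalg.msupp q -> bounded d e.
  by move=> ep; apply: bS; rewrite in_fsetU ep orbT.
have eqpol : shift_poly d p = shift_poly d q.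
  by apply/eqP; rewrite -tofrac_eq -!laurent_eval_shift // pq.
apply/malgP => e; have [eS|] := boolP (e \in S).
  by rewrite -(shift_polyE bp (bS _ eS)) eqpol shift_polyE //; exact: bS.
rewrite in_fsetU negb_or => /andP[ep eq].
by rewrite (mcoeff_outdom ep) (mcoeff_outdom eq).
Qed.

(* The Laurent expansion in z of a rational function that has one. *)
Definition laurent_of (f : rat_field R n) : malg 'rV[int]_n (coef_field R) :=
  xget 0 [set p | laurent_eval p = f].

(* The product of a Laurent polynomial by the monomial z^s, s in R^n. *)
Definition mul_monomial (s : 'rV[R]_n) (p : malg 'rV[int]_n (coef_field R)) :
    malg 'rV[R]_n (coef_field R) :=
  \sum_(e <- monalg.msupp p)
     mkmalgU (map_mx intr (e : 'rV[int]_n) + s) (monalg.mcoeff e p).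

Definition convex_hull (A : set 'rV[R]_n) : set 'rV[R]_n :=
  smallest (@convex_set R 'rV[R]_n) A.

Definition newton (f : malg 'rV[R]_n (coef_field R)) : set 'rV[R]_n :=
  convex_hull [set e | e \in monalg.msupp f].

End Laurent.

Section NewtonPolytopes.
Variables (R : realType) (n N : nat) (lam : 'I_N -> nat).
Variables (D : set 'rV[R]_N) (nu : 'rV[R]_N).

(* W^Delta_I(z_J, z, h). In every summand of the symmetrizations the factors
   1 - t^(k)_b / t^(k)_a become 1 - z_j / z_i with i and j distinct, so that
   the substitution never divides by 0. *)
Definition weight_at (I J : {ffun 'I_N -> {set 'I_n}}) : rat_field R n :=
  weight_fun lam D I (hvar R n) (fun k a => zvar R (elt J k a)) (@zvar R n).

(* The exponent of the monomial S_I(z) *)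
Definition S_exponent (I : {ffun 'I_N -> {set 'I_n}}) : 'rV[R]_n :=
  \sum_(k < N) \sum_(a in I k) (- nu ord0 k) *: delta_mx ord0 a.

Definition Wbar (I J : {ffun 'I_N -> {set 'I_n}}) :
    malg 'rV[R]_n (coef_field R) :=
  mul_monomial (S_exponent I) (laurent_of (weight_at I J)).

Definition O_polytope (I J : {ffun 'I_N -> {set 'I_n}}) : set 'rV[R]_n :=
  newton (Wbar I J).

End NewtonPolytopes.

(* Main.v *)
(** For a direction w in R^n, the w-degree (the maximum of <w, e> over the
    exponents e) extends to a valuation on rational functions, so the inclusion
    amounts to comparing w-degrees for every w, by separating a point from a
    polytope.

    A summand of W_I(z_J) is given by bijections phi_k from I_1 u ... u I_k to
    J_1 u ... u J_k, with phi_N the identity. Its factors psi with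
    i^(k+1)_c <> i^(k)_a have w-degree
    max(0, w(phi_{k+1} y) - w(phi_k x)) for y = i^(k+1)_c and x = i^(k)_a, and
    the remaining ratios have w-degree 0.
    Including the terms y = x, these maxima add up to a sum depending only on J,
    which is the w-degree of W_J(z_J), where every summand but the one with all
    phi_k = id vanishes. With delta = w(phi_{k+1} x) - w(phi_k x)
    and x in I_j, the diagonal factor therefore contributes
    - m_{j,k+1} delta - max(0, delta) <= - (nu_{k+1} - nu_j) delta,
    and the right-hand sides telescope to the difference of the w-degrees of
    S_J and S_I. *)
Require Import Defs.
From mathcomp Require Import all_boot all_order all_algebra all_fingroup.
From mathcomp Require Import complex finmap.
From mathcomp.multinomials Require mpoly monalg.
From mathcomp Require Import all_classical all_reals all_analysis.
From mathcomp Require Import lra ring.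
Import -(notations) mpoly.
Import -(notations) monalg.
Import Order.TTheory GRing.Theory Num.Theory.
Import numFieldNormedType.Exports.

Set Implicit Arguments.
Unset Strict Implicit.
Unset Printing Implicit Defensive.

Local Open Scope classical_set_scope.
Local Open Scope ring_scope.

(** * Separation of a point from a polytope *)

Section Separation.
Variables (R : realType) (n : nat).

Definition dot (w : 'I_n -> R) (x : 'rV[R]_n) : R := \sum_a w a * x ord0 a.

Lemma dotD w x y : dot w (x + y) = dot w x + dot w y.
Proof.
by rewrite -big_split; apply: eq_bigr => a _; rewrite mxE mulrDr.
Qed.

Lemma dotZ w c x : dot w (c *: x) = c * dot w x.
Proof.
by rewrite /dot mulr_sumr; apply: eq_bigr => a _; rewrite mxE mulrCA.
Qed.

Lemma dotN w x : dot w (- x) = - dot w x.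
Proof. by rewrite -scaleN1r dotZ mulN1r. Qed.

Lemma dot_sum (I : Type) (r : seq I) (P : pred I) w (F : I -> 'rV[R]_n) :
  dot w (\sum_(i <- r | P i) F i) = \sum_(i <- r | P i) dot w (F i).
Proof.
apply: (big_morph (dot w) (dotD w)).
by rewrite /dot big1 // => a _; rewrite mxE mulr0.
Qed.

Lemma dotC (x y : 'rV[R]_n) : dot (x ord0) y = dot (y ord0) x.
Proof. by apply: eq_bigr => a _; rewrite mulrC. Qed.

Lemma dot_sqrD (x y : 'rV[R]_n) (t : R) :
  dot ((x + t *: y) ord0) (x + t *: y) =
  dot (x ord0) x + t * (2 * dot (x ord0) y + t * dot (y ord0) y).
Proof.
rewrite dotD dotZ (dotC (x + t *: y) x) (dotC (x + t *: y) y) !dotD !dotZ (dotC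
  y x).
by ring.
Qed.

Lemma dot_ge0 (x : 'rV[R]_n) : 0 <= dot (x ord0) x.
Proof. by apply: sumr_ge0 => a _; rewrite -expr2 sqr_ge0. Qed.

Lemma dot_eq0 (x : 'rV[R]_n) : dot (x ord0) x = 0 -> x = 0.
Proof.
move=> x0; apply/rowP => a; rewrite mxE.
have sq (b : 'I_n) : true -> 0 <= x ord0 b * x ord0 b.
  by rewrite -expr2 sqr_ge0.
by have /eqP := psumr_eq0P sq x0 (erefl : xpredT a);
  rewrite mulf_eq0 orbb => /eqP.
Qed.

Lemma convex_setP (C : set 'rV[R]_n) x y (p : R) : convex_set C ->
  C x -> C y -> 0 <= p -> p <= 1 -> C (p *: x + (1 - p) *: y).
Proof.
move=> cC Cx Cy p0 p1; apply: set_mem.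
by apply: (cC x y (Itv01 p0 p1)); apply: mem_set.
Qed.

Lemma convex_hull_convex (A : set 'rV[R]_n) : convex_set (convex_hull A).
Proof.
move=> x y l /set_mem Ax /set_mem Ay; apply: mem_set => C [cC AC].
have CA := conj cC AC.
by apply: set_mem; apply: cC; apply: mem_set; [apply: Ax|apply: Ay].
Qed.

(** Keeping one point [x] of weight [t] apart drives the induction on [r]: each step merges [x] and
    [v i] into a single point of weight [t + c i]. *)
Lemma convex_set_sum (C : set 'rV[R]_n) (I : eqType) (r : seq I) (c : I -> R)
    (v : I -> 'rV[R]_n) (x : 'rV[R]_n) (t : R) :
  convex_set C -> C x -> (forall i, i \in r -> C (v i)) -> 0 <= t ->
  (forall i, i \in r -> 0 <= c i) -> t + \sum_(i <- r) c i = 1 ->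
  C (t *: x + \sum_(i <- r) c i *: v i).
Proof.
move=> cC; elim: r x t => [|i r IH] x t Cx Cv t0 c0.
  by rewrite !big_nil !addr0 => ->; rewrite scale1r.
rewrite !big_cons !addrA => s1.
have ci0 : 0 <= c i by apply: c0; rewrite mem_head.
have Cv' j : j \in r -> C (v j) by move=> jr; apply: Cv; rewrite inE jr orbT.
have c0' j : j \in r -> 0 <= c j by move=> jr; apply: c0; rewrite inE jr orbT.
(* With total weight 0 there is no barycentre to form, but then both terms vanish and [x] is kept
   with weight 0. *)
have [tc0|tcN0] := eqVneq (t + c i) 0.
  have /eqP := tc0; rewrite paddr_eq0 // => /andP[/eqP tE /eqP cE].
  have := IH x 0 Cx Cv' (lexx _) c0'.
  by rewrite tE cE !scale0r !addr0; apply; rewrite -[RHS]s1 tE cE addr0.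
have tc_gt0 : 0 < t + c i by rewrite lt_neqAle eq_sym tcN0 addr_ge0.
have -> : t *: x + c i *: v i =
    (t + c i) *: ((t / (t + c i)) *: x + (1 - t / (t + c i)) *: v i).
  rewrite scalerDr !scalerA mulrBr mulr1.
  have -> : (t + c i) * (t / (t + c i)) = t by field.
  by rewrite [t + c i]addrC addrK.
apply: IH => //; last exact: addr_ge0.
apply: convex_setP => //; first by apply: Cv; rewrite mem_head.
  by rewrite divr_ge0 // ltW.
by rewrite ler_pdivrMr // mul1r lerDl.
Qed.

Lemma sum_continuous (T : topologicalType) (I : Type) (r : seq I)
    (g : I -> T -> R) :
  (forall i, continuous (g i)) -> continuous (fun c => \sum_(i <- r) g i c).
Proof.
move=> cg; elim: r => [|i r IH].
  rewrite (_ : (fun _ => _) = fun=> 0); first exact: cst_continuous.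
  by apply/funext => ?; rewrite big_nil.
rewrite (_ : (fun _ => _) = fun c => g i c + \sum_(j <- r) g j c).
  by move=> c; apply: continuousD; [exact: cg|exact: IH].
by apply/funext => ?; rewrite big_cons.
Qed.

(* If x is not in the hull, the direction from the nearest point of the hull to
   x separates. *)
Lemma convex_hull_support (s : seq 'rV[R]_n) (x : 'rV[R]_n) :
  (forall w, exists2 y, y \in s & dot w x <= dot w y) ->
  convex_hull [set y | y \in s] x.
Proof.
move=> sup.
have [m Hm] : exists m, size s = m.+1.
  by case: (sup (fun=> 0)) => y; case: s {sup} => // a s' _ _; exists (size s').
(* With [x] moved to the origin, [f c] is the squared distance from [x] to the combination of
   weights [c]; it attains a minimum on the compact simplex [S]. *)
pose v (i : 'I_m.+1) := s`_i - x.
pose comb (c : 'rV[R]_m.+1) : 'rV[R]_n := \sum_i c ord0 i *: v i.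
pose f c := dot (comb c ord0) (comb c).
pose S : set 'rV[R]_m.+1 :=
  [set c | (forall i, 0 <= c ord0 i) /\ \sum_i c ord0 i = 1].
have coordc (i : 'I_m.+1) : continuous (fun c : 'rV[R]_m.+1 => c ord0 i).
  exact: coord_continuous.
have fc : continuous f.
  have combE c a : comb c ord0 a = \sum_i c ord0 i * v i ord0 a.
    by rewrite /comb summxE; apply: eq_bigr => i _; rewrite mxE.
  apply: sum_continuous => a.
  have cc : continuous (fun c => comb c ord0 a).
    rewrite (_ : (fun _ => _) =
        fun c : 'rV[R]_m.+1 => \sum_i c ord0 i * v i ord0 a); last first.
      by apply/funext => c; rewrite combE.
    apply: sum_continuous => i c; apply: continuousM; first exact: coordc.
    exact: cst_continuous.
  by move=> c; apply: continuousM; exact: cc.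
have S0 : S !=set0.
  exists (delta_mx ord0 ord0); split=> [i|]; first by rewrite mxE ler0n.
  rewrite (bigD1 ord0) //= big1 ?mxE ?eqxx ?addr0 // => i /negPf i0.
  by rewrite mxE i0 andbF.
have cS : compact S.
  apply: bounded_closed_compact.
    exists 1; split => // M M1 c [c0 c1] /=.
    apply: le_trans (ltW M1); rewrite [leLHS]/Num.norm /= mx_normrE.
    apply/bigmax_leP; split => //= -[i j] _ /=; rewrite ord1 ger0_norm //.
    by rewrite -c1 (bigD1 j) //= lerDl sumr_ge0.
  have -> : S = (\bigcap_(i in [set: 'I_m.+1]) [set c : 'rV[R]_m.+1 | 0 <= c
    ord0 i])
      `&` [set c | \sum_i c ord0 i = 1].
    apply/seteqP; split => c [c0 c1]; split => //; first by move=> i _;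
      apply: c0.
    by move=> i; apply: c0.
  apply: closedI.
    apply: closed_bigI => i _.
    apply: (@preimage_closed _ _ (fun c : 'rV[R]_m.+1 => c ord0 i)
      [set y | 0 <= y]); first by move=> c _; exact: coordc.
    exact: closed_ge.
  apply: (@preimage_closed _ _ (fun c : 'rV[R]_m.+1 => \sum_i c ord0 i)
    [set y | y = 1]); last exact: closed_eq.
  by move=> c _; apply: sum_continuous.
have [c /set_mem[c0 c1] cmin] := @EVT_min_rV R m.+1 f S S0 cS
  (continuous_subspaceT fc).
pose p := comb c.
have sE i : s`_(i : 'I_m.+1) = v i + x by rewrite subrK.
have sm (i : 'I_m.+1) : s`_i \in s by rewrite mem_nth // Hm.
(* Were p . v_i smaller than |p|^2, a small move from [c] towards the vertex [i] of the simplex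
   would shorten [p]. *)
have pv i : f c <= dot (p ord0) (v i).
  rewrite leNgt; apply/negP => lt_fc.
  pose b := dot (p ord0) (v i - p).
  have b0 : b < 0 by rewrite /b dotD dotN subr_lt0.
  pose q := dot ((v i - p) ord0) (v i - p).
  have q0 : 0 <= q := dot_ge0 _.
  have seg (t : R) : 0 <= t -> t <= 1 -> 0 <= t * (2 * b + t * q).
    move=> t0 t1.
    have St : S (c + t *: (delta_mx ord0 i - c)).
      split=> [j|].
        rewrite !mxE; set d := (_ && _)%:R.
        have -> : c ord0 j + t * (d - c ord0 j) = (1 - t) * c ord0 j + t * d.
          by ring.
        by rewrite addr_ge0 // mulr_ge0 // ?subr_ge0 // ler0n.
      under eq_bigr do rewrite !mxE.
      rewrite big_split /= -mulr_sumr sumrB c1 (bigD1 i) //= eqxx big1.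
        by rewrite addr0 subrr mulr0 addr0.
      by move=> j /negPf ->.
    have combE : comb (c + t *: (delta_mx ord0 i - c)) = p + t *: (v i - p).
      rewrite /comb; under eq_bigr do rewrite !mxE scalerDl -scalerA scalerBl.
      rewrite big_split /= -/p; congr (_ + _); rewrite -scaler_sumr sumrB;
        congr (_ *: (_ - _)).
      rewrite (bigD1 i) //= eqxx scale1r big1 ?addr0 // => j /negPf ->.
      by rewrite scale0r.
    have := cmin _ (mem_set St); rewrite /f combE -/p.
    by rewrite dot_sqrD -/b -/q lerDl.
  (* This choice gives t (1 + q) <= - b, hence 2 b + t q <= b < 0, against [seg]. *)
  pose t := Num.min 1 (- b / (1 + q)).
  have q1 : 0 < 1 + q by lra.
  have t0 : 0 < t by rewrite /t lt_min ltr01 divr_gt0 // oppr_gt0.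
  have t1 : t <= 1 by rewrite /t ge_min lexx.
  have tb : t * (1 + q) <= - b.
    by rewrite -ler_pdivlMr // /t ge_min lexx orbT.
  have := seg _ (ltW t0) t1; rewrite pmulr_rge0 //; nra.
(* In the direction - p the hypothesis yields a point of [s] with p . v_i <= 0, whereas [pv] gives
   |p|^2 <= p . v_i. *)
have {}p0 : p = 0.
  have [y ys] := sup (fun a => - p ord0 a).
  have [i im yE] := elimT (nthP 0) ys; rewrite Hm in im.
  have := pv (Ordinal im); rewrite /v /= yE.
  have dN z : dot (fun a => - p ord0 a) z = - dot (p ord0) z.
    by rewrite /dot -sumrN; apply: eq_bigr => a _; rewrite mulNr.
  rewrite !dN dotD dotN => H1 H2; apply: dot_eq0; apply/eqP.
  by rewrite eq_le dot_ge0 andbT; rewrite /f -/p in H1; lra.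
(* The term of weight 0 gives the sum the shape of [convex_set_sum]. *)
have xE : x = 0 *: s`_(@ord0 m) + \sum_i c ord0 i *: s`_i.
  rewrite scale0r add0r; under eq_bigr do rewrite sE scalerDr.
  by rewrite big_split /= -scaler_suml c1 scale1r -/(comb c) -/p p0 add0r.
have hull (i : 'I_m.+1) : convex_hull [set y | y \in s] s`_i.
  by apply: sub_gen_smallest; exact: sm.
rewrite xE; apply: convex_set_sum => //; last by rewrite add0r.
exact: convex_hull_convex.
Qed.

End Separation.

(** * Ordered partitions and the increasing enumeration of their partial unions *)

Section OrderedPartitions.
Variables (n N : nat) (lam : 'I_N -> nat).
Implicit Types (I J : {ffun 'I_N -> {set 'I_n}}) (A : {set 'I_n}).

Lemma ordered_partitionsP I : I \in ordered_partitions n lam ->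
  [/\ forall k, #|I k| = lam k,
      forall j k x, x \in I j -> x \in I k -> j = k &
      forall x, exists k, x \in I k].
Proof.
rewrite inE => /and3P[/forallP Ic /forallP Id /eqP Iu]; split.
- by move=> k; apply/eqP.
- move=> j k x xj xk; apply/eqP; apply: contraLR xk => jk.
  have /forallP/(_ k) := Id j; rewrite jk /= => /disjointFr.
  by move=> /(_ x xj) ->.
- move=> x; have : x \in [set: 'I_n]%SET by rewrite inE.
  by rewrite -Iu => /bigcupP[k _ xk]; exists k.
Qed.

Lemma in_union_upto I k x :
  reflect (exists2 j : 'I_N, (j < k)%N & x \in I j) (x \in union_upto I k).
Proof. exact: bigcupP. Qed.

Section Fixed.
Variable (I : {ffun 'I_N -> {set 'I_n}}).
Hypothesis IP : I \in ordered_partitions n lam.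

Lemma block_ofP j0 j x : (x \in I j) = (block_of I j0 x == j).
Proof.
have [_ Id Iu] := ordered_partitionsP IP.
rewrite /block_of; case: pickP => [i xi|xN] /=.
  by apply/idP/eqP => [/(Id _ _ _ xi)|<-].
by have [k] := Iu x; rewrite xN.
Qed.

Lemma union_uptoE j0 k x : (x \in union_upto I k) = (block_of I j0 x < k)%N.
Proof.
apply/in_union_upto/idP => [[j jk]|bk];
  first by rewrite (block_ofP j0) => /eqP ->.
by exists (block_of I j0 x); rewrite ?(block_ofP j0).
Qed.

Lemma big_union_upto (S : Type) (idx : S) (op : Monoid.com_law idx) k
    (G : 'I_n -> S) :
  \big[op/idx]_(x in union_upto I k) G x =
  \big[op/idx]_(j < N | (j < k)%N) \big[op/idx]_(x in I j) G x.
Proof.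
(* [block_of] needs a default component, so the case without components, where both sides are empty,
   is treated apart. *)
case: (pickP (fun _ : 'I_N => true)) => [j0 _|N0]; last first.
  rewrite [RHS]big_pred0; last by move=> j; have := N0 j.
  by rewrite big_pred0 // => x; apply/negP => /in_union_upto[j]; have := N0 j.
rewrite (partition_big (block_of I j0) (fun j : 'I_N => (j < k)%N)) /=.
  apply: eq_bigr => j jk; apply: eq_bigl => x.
  by rewrite (union_uptoE j0) (block_ofP j0); case: eqP => [->|];
    rewrite ?jk ?andbF.
by move=> x; rewrite (union_uptoE j0).
Qed.

Lemma card_union_upto k : #|union_upto I k| = lamsum lam k.
Proof.
have [Ic _ _] := ordered_partitionsP IP.
rewrite -sum1_card big_union_upto; apply: eq_bigr => j _.
by rewrite sum1_card.
Qed.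

Lemma union_uptoT k : (N <= k)%N -> union_upto I k = [set: 'I_n]%SET.
Proof.
have [_ _ Iu] := ordered_partitionsP IP => Nk.
apply/setP => x; rewrite inE; apply/in_union_upto.
by have [j xj] := Iu x; exists j => //; apply: leq_trans Nk.
Qed.

Lemma sub_union_upto k : union_upto I k \subset union_upto I k.+1.
Proof.
apply/fintype.subsetP => x /in_union_upto[j jk xj]; apply/in_union_upto.
by exists j => //; apply: leqW.
Qed.

Lemma lamsum_le k : (lamsum lam k <= n)%N.
Proof. by rewrite -card_union_upto -[leqRHS]card_ord max_card. Qed.

Lemma elt_in k (a : 'I_n) : (a < lamsum lam k)%N ->
  elt I k a \in union_upto I k.
Proof. by move=> ak; rewrite -mem_enum mem_nth // -cardE card_union_upto. Qed.

Lemma elt_surj k x : x \in union_upto I k ->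
  exists2 a : 'I_n, (a < lamsum lam k)%N & elt I k a = x.
Proof.
rewrite -mem_enum => xI; have := xI.
rewrite -index_mem -cardE card_union_upto => lt_k.
exists (Ordinal (leq_trans lt_k (lamsum_le k))) => //.
by rewrite /elt /= nth_index.
Qed.

Lemma elt_mono k (a b : 'I_n) : (a < lamsum lam k)%N -> (b < lamsum lam k)%N ->
  (elt I k a < elt I k b)%N = (a < b)%N.
Proof.
move=> ak bk.
have lt_elt (c d : 'I_n) : (c < d)%N -> (d < lamsum lam k)%N ->
    (elt I k c < elt I k d)%N.
  move=> cd dk.
  have se : sorted (fun x y : 'I_n => (x < y)%N) (enum (union_upto I k)).
    rewrite /enum_mem; apply: sorted_filter; first by move=> x y z;
      exact: ltn_trans.
    have := iota_ltn_sorted 0 n.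
    by rewrite -val_enum_ord sorted_map enumT.
  rewrite /elt (set_nth_default d) -?cardE ?card_union_upto ?(ltn_trans cd) //.
  apply: (sorted_ltn_nth _ _ se) => //; first by move=> x y z; exact: ltn_trans.
    by rewrite inE -cardE card_union_upto (ltn_trans cd).
  by rewrite inE -cardE card_union_upto.
case: (ltngtP a b) => [ab|ba|/val_inj ->]; first exact: lt_elt.
  by apply/negbTE; rewrite -leqNgt ltnW ?lt_elt.
by rewrite ltnn.
Qed.

Lemma elt_inj k (a b : 'I_n) : (a < lamsum lam k)%N -> (b < lamsum lam k)%N ->
  elt I k a = elt I k b -> a = b.
Proof.
move=> ak bk eab; apply/val_inj/eqP.
have := elt_mono ak bk; have := elt_mono bk ak; rewrite eab ltnn.
by case: ltngtP.
Qed.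

(** Inverse of [elt I k] on positions below lambda^(k); the default [x] is arbitrary. *)
Definition elt_rank k (x : 'I_n) : 'I_n :=
  odflt x [pick a : 'I_n | (a < lamsum lam k)%N && (elt I k a == x)].

Lemma elt_rankK k (a : 'I_n) : (a < lamsum lam k)%N ->
  elt_rank k (elt I k a) = a.
Proof.
move=> ak; rewrite /elt_rank; case: pickP => [b /andP[bk /eqP]|/(_ a)].
  exact: elt_inj.
by rewrite ak eqxx.
Qed.

Lemma big_elt (S : Type) (idx : S) (op : Monoid.com_law idx) k
    (G : 'I_n -> S) :
  \big[op/idx]_(a < n | (a < lamsum lam k)%N) G (elt I k a) =
  \big[op/idx]_(x in union_upto I k) G x.
Proof.
rewrite [RHS](reindex_onto (elt I k) (elt_rank k)); last first.
  by move=> x /elt_surj[a ak <-]; rewrite elt_rankK.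
apply: eq_bigl => a; apply/idP/andP => [ak|[/elt_surj[b bk <-]]].
  by rewrite elt_in // elt_rankK.
by rewrite elt_rankK // => /eqP <-.
Qed.

(** From level N on the partial union is everything; this makes the substitution z_J compatible with
    the convention t^(N)_a = z_a. *)
Lemma elt_topE k (a : 'I_n) : (N <= k)%N -> elt I k a = a.
Proof.
by move=> Nk; rewrite /elt union_uptoT // enum_setT -enumT nth_ord_enum.
Qed.

End Fixed.
End OrderedPartitions.

(** * The inequality between degrees, for a family of bijections phi_k *)

Section DegreeBound.
Variables (R : realType) (n N : nat) (lam : 'I_N -> nat).

Lemma sum_ord_ltS (V : zmodType) (M : nat) (ltMN : (M < N)%N)
    (F : 'I_N -> V) :
  \sum_(k < N | (k < M.+1)%N) F k =
  \sum_(k < N | (k < M)%N) F k + F (Ordinal ltMN).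
Proof.
rewrite (bigD1 (Ordinal ltMN)) //= addrC; congr (_ + _).
by apply: eq_bigl => k; rewrite ltnS ltn_neqAle andbC.
Qed.

Lemma sum_union_uptoS (V : zmodType) (I : {ffun 'I_N -> {set 'I_n}}) (M : nat)
    (ltMN : (M < N)%N) (G : 'I_n -> V) : I \in ordered_partitions n lam ->
  \sum_(x in union_upto I M.+1) G x =
  \sum_(x in union_upto I M) G x + \sum_(x in I (Ordinal ltMN)) G x.
Proof. by move=> IP; rewrite !(big_union_upto IP) sum_ord_ltS. Qed.

Lemma sum_union_upto0 (V : zmodType) (I : {ffun 'I_N -> {set 'I_n}})
    (G : 'I_n -> V) : \sum_(x in union_upto I 0) G x = 0.
Proof. by rewrite big_pred0 // => x; apply/negP => /in_union_upto[]. Qed.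

Lemma dot_S_exponent (nu : 'rV[R]_N) (I : {ffun 'I_N -> {set 'I_n}})
    (w : 'I_n -> R) :
  dot w (S_exponent nu I) = - \sum_(k < N) nu ord0 k * \sum_(x in I k) w x.
Proof.
rewrite dot_sum -sumrN; apply: eq_bigr => k _.
rewrite dot_sum mulr_sumr -sumrN; apply: eq_bigr => x _.
rewrite dotZ mulNr; congr (- (_ * _)).
rewrite /dot (bigD1 x) //= big1 ?addr0; last first.
  by move=> y /negPf yx; rewrite mxE yx andbF mulr0.
by rewrite mxE !eqxx mulr1.
Qed.

Variables (Delta : set 'rV[R]_N) (nu : 'rV[R]_N) (j0 : 'I_N).
Variables (I J : {ffun 'I_N -> {set 'I_n}}).
Hypotheses (IP : I \in ordered_partitions n lam)
  (JP : J \in ordered_partitions n lam).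
Hypotheses (alcD : alcove Delta) (Dnu : Delta nu).
Variables (w : 'I_n -> R) (phi : nat -> 'I_n -> 'I_n).

(* phi k is, up to irrelevant values, a bijection from I_1 u ... u I_k to
   J_1 u ... u J_k. *)
Hypothesis phiP : forall k (G : 'I_n -> R), (k <= N)%N ->
  \sum_(x in union_upto I k) G (phi k x) = \sum_(x in union_upto J k) G x.
Hypothesis phiN : forall x, phi N x = x.

Let b := block_of I j0.
Let step k x := w (phi k.+1 x) - w (phi k x).

(** Summation by parts. For fixed [x] the steps telescope from the level at which [x] enters up to
    phi_N x = x. For fixed [k] the steps, together with the values of [w] at the images of the
    points of [I k], add up to the sum of [w] over [J k]. *)
Lemma telescope_steps :
  \sum_(k < N) \sum_(x in union_upto I k)
      (nu ord0 k - nu ord0 (b x)) * step k x +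
    \sum_(k < N) nu ord0 k * \sum_(x in I k) w x =
  \sum_(k < N) nu ord0 k * \sum_(x in J k) w x.
Proof.
(* The identity truncated at level [M]; phi_M need not be the identity there, so [w (phi M x)]
   stands in place of [w x]. *)
have partial M : (M <= N)%N ->
    \sum_(k < N | (k < M)%N) \sum_(x in union_upto I k)
      (nu ord0 k - nu ord0 (b x)) * step k x +
    \sum_(x in union_upto I M) nu ord0 (b x) * w (phi M x) =
    \sum_(k < N | (k < M)%N) nu ord0 k * \sum_(x in J k) w x.
  elim: M => [_|M IH ltMN].
    by rewrite sum_union_upto0 !big_pred0 // addr0.
  rewrite !(sum_ord_ltS ltMN) -IH ?(ltnW ltMN) // (sum_union_uptoS ltMN _ IP).
  set K := Ordinal ltMN.
  (* This is the difference of [phiP] at the levels [M.+1] and [M]. *)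
  have -> : \sum_(x in J K) w x = \sum_(x in union_upto I M) step M x +
      \sum_(x in I K) w (phi M.+1 x).
    have := sum_union_uptoS ltMN w JP; have := phiP w ltMN.
    rewrite -(phiP w (ltnW ltMN)) => <-.
    rewrite (sum_union_uptoS ltMN _ IP) sumrB => E.
    apply: (addrI (\sum_(x in union_upto I M) w (phi M x))).
    by rewrite -E; ring.
  have -> : \sum_(x in I K) nu ord0 (b x) * w (phi M.+1 x) =
      nu ord0 K * \sum_(x in I K) w (phi M.+1 x).
    rewrite mulr_sumr; apply: eq_bigr => x.
    by rewrite (block_ofP IP j0) => /eqP <-.
  have -> : \sum_(x in union_upto I M)
      (nu ord0 K - nu ord0 (b x)) * step M x =
      nu ord0 K * \sum_(x in union_upto I M) step M x +
      \sum_(x in union_upto I M) nu ord0 (b x) * w (phi M x) -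
      \sum_(x in union_upto I M) nu ord0 (b x) * w (phi M.+1 x).
    rewrite mulr_sumr -big_split -sumrB; apply: eq_bigr => x _.
    by rewrite /step /=; ring.
  by ring.
have := partial N (leqnn N).
rewrite (eq_bigl xpredT); last by move=> k; rewrite ltn_ord.
rewrite [RHS](eq_bigl xpredT); last by move=> k; rewrite ltn_ord.
move=> <-; congr (_ + _); rewrite (big_union_upto IP).
rewrite [RHS](eq_bigl xpredT); last by move=> k; rewrite ltn_ord.
apply: eq_bigr => k _; rewrite mulr_sumr; apply: eq_bigr => x.
by rewrite phiN (block_ofP IP j0) => /eqP <-.
Qed.

(** Degree bound for the factor [psi] with x = i^(k)_a and y = i^(k+1)_c. It is the exact degree
    unless a factor 1 - z_v / z_u has u = v and vanishes. *)
Definition psi_deg (k : 'I_N) (x y : 'I_n) : R :=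
  if y == x then (- int_char Delta (b x) k)%:~R * step k x
  else Num.max 0 (w (phi k.+1 y) - w (phi k x)).

Lemma sum_psi_deg_le :
  \sum_(k < N) \sum_(x in union_upto I k) \sum_(y in union_upto I k.+1)
      psi_deg k x y + dot w (S_exponent nu I) <=
  \sum_(k < N) \sum_(x in union_upto J k) \sum_(y in union_upto J k.+1)
      Num.max 0 (w y - w x) + dot w (S_exponent nu J).
Proof.
rewrite !dot_S_exponent -telescope_steps opprD addrA lerD2r.
rewrite -sumrB; apply: ler_sum => k _.
have -> : \sum_(x in union_upto J k) \sum_(y in union_upto J k.+1)
    Num.max 0 (w y - w x) = \sum_(x in union_upto I k)
    \sum_(y in union_upto I k.+1) Num.max 0 (w (phi k.+1 y) - w (phi k x)).
  rewrite -(phiP _ (ltnW (ltn_ord k))); apply: eq_bigr => x _.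
  by rewrite -(phiP (fun y => Num.max 0 (w y - _)) (ltn_ord k)).
rewrite -sumrB; apply: ler_sum => x xk.
have xk1 : x \in union_upto I k.+1 by apply: fintype.subsetP xk;
  exact: sub_union_upto.
(* The two inner sums differ only in the term y = x. *)
rewrite (bigD1 x) //= [X in _ <= X - _](bigD1 x) //= /psi_deg eqxx.
rewrite [X in _ + X](eq_bigr (fun y =>
  Num.max 0 (w (phi k.+1 y) - w (phi k x)))).
  have bk : (b x < k)%N by rewrite -(union_uptoE IP).
  rewrite (int_charE alcD Dnu bk).
  set d := nu ord0 k - nu ord0 (b x); set s := \sum_(y in _ | _) _.
  rewrite -[w _ - w _]/(step k x) addrAC lerD2r.
  have := floor_le d; have := floorD1_gt d; rewrite rmorphN rmorphD /=.
  set m := (Num.floor d)%:~R; set u := step k x.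
  (* What remains is - m u <= max(0, u) - d u with m the floor of d: for u >= 0 it follows from d <
     m + 1, for u < 0 from m <= d. *)
  by case: (leP 0 u) => u0; nra.
by move=> y /andP[_ /negPf ->].
Qed.

End DegreeBound.

(** * The degree in direction w, for polynomials and for their fractions *)

Section Degree.
Variables (R : realType) (K : fieldType) (n : nat) (w : 'I_n -> R).
Notation A := (mpoly n K).
Notation Frac := {fraction A}.
Implicit Types (p q : A) (f g : Frac) (d e : R) (m : multinom n).

Definition wt m : R := \sum_a w a * (m a)%:R.

Lemma wtD m1 m2 : wt (mnm_add m1 m2) = wt m1 + wt m2.
Proof.
by rewrite -big_split; apply: eq_bigr => a _; rewrite mnmDE natrD mulrDr.
Qed.

Lemma wt0 : wt (@mnm0 n) = 0.
Proof. by rewrite /wt big1 // => a _; rewrite mnm0E mulr0. Qed.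

Lemma wt1 a : wt (mnm1 a) = w a.
Proof.
rewrite /wt (bigD1 a) //= big1 => [|b ba];
  first by rewrite mnm1E eqxx mulr1 addr0.
by rewrite mnm1E eq_sym (negPf ba) mulr0.
Qed.

(** The zero polynomial satisfies every [deg_le] and no [deg_eq], so vanishing terms are bounded
    without a degree minus infinity. *)
Definition deg_le p d := forall m, m \in mpoly.msupp p -> wt m <= d.
Definition deg_eq p d := deg_le p d /\ exists2 m,
  m \in mpoly.msupp p & wt m = d.

Lemma deg_eq_neq0 p d : deg_eq p d -> p != 0.
Proof. by move=> [_ [m mp _]]; rewrite -mpoly.msupp_eq0;
  case: mpoly.msupp mp. Qed.

Lemma deg_eq_exists p : p != 0 -> exists d, deg_eq p d.
Proof.
rewrite -mpoly.msupp_eq0 => p0.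
have [m mp mmax] : exists2 m, m \in mpoly.msupp p & deg_le p (wt m).
  rewrite /deg_le; elim: (mpoly.msupp p : seq _) p0 => // m [|m' s] IH _.
    by exists m; rewrite ?mem_head // => m'; rewrite inE => /eqP ->.
  have [m0 m0s m0max] := IH isT.
  case: (leP (wt m0) (wt m)) => mm.
    exists m; first exact: mem_head.
    move=> m1; rewrite inE => /predU1P[-> //|/m0max le_m1].
    exact: le_trans le_m1 mm.
  exists m0; first by rewrite inE m0s orbT.
  by move=> m1; rewrite inE => /predU1P[->|/m0max //]; exact: ltW.
by exists (wt m); split => //; exists m.
Qed.

Lemma msuppM_wt p q m : m \in mpoly.msupp (p * q) ->
  exists m1 m2, [/\ m1 \in mpoly.msupp p,
    m2 \in mpoly.msupp q & wt m = wt m1 + wt m2].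
Proof.
by move=> /mpoly.msuppM_le/allpairsP[[m1 m2] /= [m1p m2q ->]]; exists m1, m2;
  rewrite wtD.
Qed.

Lemma deg_leM p q d e : deg_le p d -> deg_le q e -> deg_le (p * q) (d + e).
Proof.
move=> pd qe m /msuppM_wt[m1 [m2 [m1p m2q ->]]].
by apply: lerD; [exact: pd|exact: qe].
Qed.

Lemma deg_leD p q d : deg_le p d -> deg_le q d -> deg_le (p + q) d.
Proof.
move=> pd qd m /mpoly.msuppD_le; rewrite mem_cat => /orP[];
  [exact: pd|exact: qd].
Qed.

Lemma deg_leW p d e : d <= e -> deg_le p d -> deg_le p e.
Proof. by move=> de pd m mp; apply: le_trans de; exact: pd. Qed.

Lemma top_part p d : deg_eq p d ->
  exists p1 p2, [/\ p = p1 + p2, p1 != 0,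
    forall m, m \in mpoly.msupp p1 -> wt m = d &
    forall m, m \in mpoly.msupp p2 -> wt m < d].
Proof.
move=> [pd [m0 m0p m0d]].
pose part (P : pred (multinom n)) : A :=
  \sum_(m <- mpoly.msupp p | P m) mpoly.mcoeff m p *: mpolyX _ m.
have coef_part P m : mpoly.mcoeff m (part P) = mpoly.mcoeff m p * (P m)%:R.
  rewrite /part raddf_sum /=.
  under eq_bigr do rewrite mpoly.mcoeffZ mpoly.mcoeffX.
  have [mp|mp] := boolP (m \in mpoly.msupp p).
    rewrite big_mkcond (bigD1_seq m) ?mpoly.msupp_uniq //= eqxx mulr1 big1
      ?addr0.
      by case: (P m); rewrite ?mulr1 ?mulr0.
    by move=> m' /negPf m'm; rewrite m'm mulr0 if_same.
  rewrite (memN_msupp_eq0 mp) mul0r big1_seq // => m' /andP[_ m'p].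
  have [m'm|_] := eqVneq m' m; last by rewrite mulr0.
  by rewrite -m'm m'p in mp.
exists (part (fun m => wt m == d)), (part (fun m => wt m != d)); split.
- apply/mpolyP => m; rewrite mpoly.mcoeffD !coef_part.
  by case: (wt m == d); rewrite /= mulr1 mulr0 ?addr0 ?add0r.
- apply/eqP => /(congr1 (mpoly.mcoeff m0)); rewrite coef_part m0d eqxx mulr1.
  by move/eqP; rewrite mpoly.mcoeff0 mpoly.mcoeff_eq0 m0p.
- move=> m; rewrite mcoeff_msupp coef_part.
  by case: (wt m =P d) => //= _; rewrite mulr0 eqxx.
- move=> m; rewrite mcoeff_msupp coef_part lt_neqAle.
  have [mp|mp] := boolP (m \in mpoly.msupp p);
    last by rewrite (memN_msupp_eq0 mp) mul0r eqxx.
  by rewrite pd // andbT; case: (wt m == d); rewrite //= mulr0 eqxx.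
Qed.

(* The top homogeneous parts multiply to a nonzero polynomial. *)
Lemma deg_eqM p q d e : deg_eq p d -> deg_eq q e -> deg_eq (p * q) (d + e).
Proof.
move=> pd qe; split; first by apply: deg_leM; [case: pd|case: qe].
have [p1 [p2 [-> p10 p1d p2d]]] := top_part pd.
have [q1 [q2 [-> q10 q1e q2e]]] := top_part qe.
have : p1 * q1 != 0 by rewrite mulf_neq0.
rewrite -mpoly.msupp_eq0; case E : (mpoly.msupp (p1 * q1) : seq _) =>
  [//|m s] _.
have m11 : m \in mpoly.msupp (p1 * q1) by rewrite E mem_head.
have wm : wt m = d + e.
  by have [m1 [m2 [/p1d <- /q1e <- ->]]] := msuppM_wt m11.
(* A product with one factor strictly below its bound cannot reach the weight d + e of [m]; this
   removes every product but [p1 * q1]. *)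
have low (r s' : A) (dr ds : R) : (forall m, m \in mpoly.msupp r ->
  wt m <= dr) ->
    (forall m, m \in mpoly.msupp s' -> wt m <= ds) ->
    ((forall m, m \in mpoly.msupp r -> wt m < dr) \/
     (forall m, m \in mpoly.msupp s' -> wt m < ds)) ->
    dr + ds = d + e -> mpoly.mcoeff m (r * s') = 0.
  move=> rd sd rs dde; apply/eqP; rewrite mpoly.mcoeff_eq0; apply/negP.
  move=> /msuppM_wt[m1 [m2 [m1r m2s]]]; rewrite wm -dde => E'.
  have := rd _ m1r; have := sd _ m2s.
  by case: rs => [/(_ _ m1r)|/(_ _ m2s)]; lra.
have le1 m' : m' \in mpoly.msupp p1 -> wt m' <= d by move=> /p1d ->.
have le2 m' : m' \in mpoly.msupp q1 -> wt m' <= e by move=> /q1e ->.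
have le3 m' : m' \in mpoly.msupp p2 -> wt m' <= d by move=> /p2d/ltW.
have le4 m' : m' \in mpoly.msupp q2 -> wt m' <= e by move=> /q2e/ltW.
exists m => //; rewrite mcoeff_msupp mulrDl !mulrDr !mpoly.mcoeffD.
rewrite (low p1 q2 d e) ?(low p2 q1 d e) ?(low p2 q2 d e) ?addr0 -?mcoeff_msupp
  //;
  by [left|right].
Qed.

Lemma deg_eqC (c : K) : c != 0 -> deg_eq (mpolyC n c) 0.
Proof.
move=> c0; split=> [m|].
  by rewrite mpoly.msuppC (negPf c0) inE => /eqP ->; rewrite wt0.
by exists (@mnm0 n); rewrite ?wt0 // mpoly.msuppC (negPf c0) mem_head.
Qed.

Lemma deg_eqX m : deg_eq (mpolyX _ m) (wt m).
Proof.
by split=> [m'|]; [|exists m => //]; rewrite mpoly.msuppX inE // => /eqP ->.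
Qed.

Lemma deg_eq_max p d m1 m2 : (forall m,
  (m \in mpoly.msupp p) = (m == m1) || (m == m2)) ->
  d = Num.max (wt m1) (wt m2) -> deg_eq p d.
Proof.
move=> suppp ->; split=> [m|].
  by rewrite suppp le_max => /orP[]/eqP ->; rewrite lexx ?orbT.
by case: (leP (wt m1) (wt m2)) => _; [exists m2|exists m1];
  rewrite ?suppp ?eqxx ?orbT.
Qed.

Lemma deg_eq_binomial (c : K) (a b : 'I_n) : c != 0 -> a != b ->
  deg_eq (mpolyX _ (mnm1 a) - mpolyC n c * mpolyX _ (mnm1 b))
    (Num.max (w a) (w b)).
Proof.
move=> c0 ab.
apply: (@deg_eq_max _ _ (mnm1 a) (mnm1 b)); last by rewrite !wt1.
have m_ab : mnm1 a != mnm1 b.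
  apply: contraNneq ab => /(congr1 (fun m : multinom n => m a)).
  by rewrite !mnm1E eqxx [b == a]eq_sym; case: (a == b).
move=> m; rewrite mcoeff_msupp mpoly.mcoeffB mul_mpolyC mpoly.mcoeffZ
  !mpoly.mcoeffX.
rewrite ![_ == m]eq_sym; case: (eqVneq m (mnm1 a)) => [->|_] /=.
  by rewrite (negPf m_ab) mulr0 subr0 oner_neq0.
by case: (m == mnm1 b); rewrite /= ?mulr1 ?mulr0 sub0r ?oppr_eq0 ?c0 ?oppr0
  ?eqxx.
Qed.

(** A relation rather than a function: no representative of the fraction has to be chosen, and
    closure under products and inverses is immediate. The companion [fdeg_le] also covers f = 0. *)
Definition fdeg f d := exists p q dp dq,
  [/\ deg_eq p dp, deg_eq q dq, f = tofrac p / tofrac q & d = dp - dq].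

Definition fdeg_le f d := exists p q e,
  [/\ deg_le p (d + e), deg_eq q e & f = tofrac p / tofrac q].

Lemma fdegP p d : deg_eq p d -> fdeg (tofrac p) d.
Proof.
move=> pd; exists p, 1, d, 0; split=> //; last by rewrite subr0.
  by rewrite -(mpoly.mpolyC1 n K); apply: deg_eqC; exact: oner_neq0.
by rewrite rmorph1 divr1.
Qed.

Lemma fdegM f g d e : fdeg f d -> fdeg g e -> fdeg (f * g) (d + e).
Proof.
move=> [p [q [dp [dq [pd qd -> ->]]]]] [p' [q' [dp' [dq' [pd' qd' -> ->]]]]].
exists (p * p'), (q * q'), (dp + dp'), (dq + dq').
split; [exact: deg_eqM|exact: deg_eqM| |by ring].
by rewrite !rmorphM /= invfM mulrACA.
Qed.

Lemma fdegV f d : fdeg f d -> fdeg f^-1 (- d).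
Proof.
move=> [p [q [dp [dq [pd qd -> ->]]]]]; exists q, p, dq, dp.
by split=> //; [rewrite invfM invrK mulrC|rewrite opprB].
Qed.

Lemma fdeg1 : fdeg 1 0.
Proof.
rewrite -(rmorph1 (@tofrac A)); apply: fdegP.
by rewrite -(mpoly.mpolyC1 n K); apply: deg_eqC; exact: oner_neq0.
Qed.

Lemma fdeg_neq0 f d : fdeg f d -> f != 0.
Proof.
move=> [p [q [dp [dq [pd qd -> _]]]]].
by rewrite mulf_neq0 ?invr_eq0 // tofrac_eq0 ?(deg_eq_neq0 pd) ?(deg_eq_neq0
  qd).
Qed.

Lemma fdegX f d k : fdeg f d -> fdeg (f ^+ k) (k%:R * d).
Proof.
move=> fd; elim: k => [|k IH]; first by rewrite expr0 mul0r; exact: fdeg1.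
by rewrite exprS -natr1 mulrDl mul1r addrC; exact: fdegM.
Qed.

Lemma fdegXz f d (k : int) : fdeg f d -> fdeg (f ^ k) (k%:~R * d).
Proof.
move=> fd; case: k => k; first by exact: fdegX.
by rewrite NegzE rmorphN mulNr -exprnN; apply: fdegV; exact: fdegX.
Qed.

Lemma fdeg_prod (T : Type) (r : seq T) (P : pred T) (F : T -> Frac) (D : T ->
  R) :
  (forall i, P i -> fdeg (F i) (D i)) ->
  fdeg (\prod_(i <- r | P i) F i) (\sum_(i <- r | P i) D i).
Proof.
by move=> FD; elim/big_ind2: _ => //; [exact: fdeg1|move=> *; exact: fdegM].
Qed.

Lemma fdeg_leM f g d e : fdeg_le f d -> fdeg_le g e -> fdeg_le (f * g) (d + e).
Proof.
move=> [p [q [dq [pd qd ->]]]] [p' [q' [dq' [pd' qd' ->]]]].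
exists (p * p'), (q * q'), (dq + dq').
split; [|exact: deg_eqM|by rewrite !rmorphM /= invfM mulrACA].
by rewrite addrACA; exact: deg_leM.
Qed.

Lemma fdeg_leD f g d : fdeg_le f d -> fdeg_le g d -> fdeg_le (f + g) d.
Proof.
move=> [p [q [dq [pd qd ->]]]] [p' [q' [dq' [pd' qd' ->]]]].
exists (p * q' + p' * q), (q * q'), (dq + dq'); split.
- apply: deg_leD; first by rewrite addrA; apply: deg_leM => //; case: qd'.
  by rewrite (addrC dq) addrA; apply: deg_leM => //; case: qd.
- exact: deg_eqM.
- rewrite addf_div ?tofrac_eq0 ?(deg_eq_neq0 qd) ?(deg_eq_neq0 qd') //.
  by rewrite rmorphD !rmorphM.
Qed.

Lemma fdeg_le0 d : fdeg_le 0 d.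
Proof.
exists 0, 1, 0; split; last by rewrite rmorph0 mul0r.
  by move=> m; rewrite mcoeff_msupp mpoly.mcoeff0 eqxx.
by rewrite -(mpoly.mpolyC1 n K); apply: deg_eqC; exact: oner_neq0.
Qed.

Lemma fdegW f d e : d <= e -> fdeg f d -> fdeg_le f e.
Proof.
move=> de [p [q [dp [dq [[pd _] qd -> dE]]]]]; exists p, q, dq.
by split=> //; apply: deg_leW pd; rewrite -lerBlDr -dE.
Qed.

Lemma fdeg_leW f d e : d <= e -> fdeg_le f d -> fdeg_le f e.
Proof.
move=> de [p [q [dq [pd qd ->]]]]; exists p, q, dq; split=> //.
by apply: deg_leW pd; rewrite lerD2r.
Qed.

Lemma fdeg_le_prod (T : Type) (r : seq T) (P : pred T) (F : T -> Frac)
    (D : T -> R) : (forall i, P i -> fdeg_le (F i) (D i)) ->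
  fdeg_le (\prod_(i <- r | P i) F i) (\sum_(i <- r | P i) D i).
Proof.
move=> FD; elim/big_ind2: _ => //; last by move=> *; exact: fdeg_leM.
exact: fdegW (lexx _) fdeg1.
Qed.

Lemma tofrac_mpolyCB1 (c : K) :
  tofrac (mpolyC n (1 - c)) = 1 - tofrac (mpolyC n c).
Proof. by rewrite mpolyCB mpoly.mpolyC1 rmorphB rmorph1. Qed.

Lemma fdegC (c : K) : c != 0 -> fdeg (tofrac (mpolyC n c)) 0.
Proof. by move=> c0; apply: fdegP; exact: deg_eqC. Qed.

(** If p = p' / q as fractions, then p q = p', and additivity of the degree turns the bounds on p'
    and q into one on p, whatever the representation. *)
Lemma fdeg_le_polynomial p d m : fdeg_le (tofrac p) d -> m \in mpoly.msupp p ->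
  wt m <= d.
Proof.
move=> [p' [q [e [p'd qe E]]]] mp.
have p0 : p != 0 by rewrite -mpoly.msupp_eq0; case: mpoly.msupp mp.
have [c pc] := deg_eq_exists p0.
have pq : p * q = p'.
  apply/eqP; rewrite -tofrac_eq rmorphM /= E mulfVK //.
  by rewrite tofrac_eq0 (deg_eq_neq0 qe).
have [_ [m' m'pq m'E]] := deg_eqM pc qe; rewrite pq in m'pq.
apply: (@le_trans _ _ c); first by case: pc => pc _; exact: pc.
by rewrite -(lerD2r e) -m'E; exact: p'd.
Qed.

Lemma fdeg_polynomial p d : fdeg (tofrac p) d ->
  exists2 m, m \in mpoly.msupp p & wt m = d.
Proof.
move=> pd; have [p' [q [c [e [p'c qe E dE]]]]] := pd.
have p0 : p != 0 by rewrite -tofrac_eq0 (fdeg_neq0 pd).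
have [c' pc'] := deg_eq_exists p0; have [_ [m mp mc']] := pc'.
exists m => //; rewrite mc'; apply/eqP; rewrite eq_le.
rewrite -{1}mc' (fdeg_le_polynomial (fdegW (lexx _) pd) mp) /=.
have pq : p * q = p'.
  apply/eqP; rewrite -tofrac_eq rmorphM /= E mulfVK //.
  by rewrite tofrac_eq0 (deg_eq_neq0 qe).
have [+ _] := deg_eqM pc' qe; rewrite pq dE lerBlDr.
by case: p'c => _ [m' m'p' <-]; apply.
Qed.

End Degree.

(** * Degrees of the binomials that occur in weight functions *)

Section DegreeOfRatios.
Variables (R : realType) (n : nat) (w : 'I_n -> R).
Notation K := (coef_field R).
Notation h := (hvar R n).
Notation z := (@zvar R n).
Implicit Types (a b : 'I_n).

Lemma fdeg_zvar a : fdeg w (zvar R a) (w a).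
Proof. by rewrite -wt1; apply: fdegP; exact: deg_eqX. Qed.

Lemma zvar_neq0 (a : 'I_n) : zvar R a != 0.
Proof. by rewrite /zvar tofrac_eq0 -mpoly.msupp_eq0 mpoly.msuppX. Qed.

Lemma zvar_divff (a : 'I_n) : zvar R a / zvar R a = 1.
Proof. by rewrite divff ?zvar_neq0. Qed.

Lemma fdeg_ratio a b : fdeg w (zvar R b / zvar R a) (w b - w a).
Proof. by apply: fdegM (fdegV _); exact: fdeg_zvar. Qed.

(** Clearing the denominator leaves z_a - c z_b, two distinct monomials that cannot cancel. *)
Lemma fdeg_binomial (c : K) a b : c != 0 -> a != b ->
  fdeg w (1 - tofrac (mpolyC n c) * (zvar R b / zvar R a))
    (Num.max 0 (w b - w a)).
Proof.
move=> c0 ab.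
have -> : 1 - tofrac (mpolyC n c) * (zvar R b / zvar R a) =
    tofrac (mpolyX _ (mnm1 a) - mpolyC n c * mpolyX _ (mnm1 b)) / zvar R a.
  by rewrite rmorphB rmorphM /= -!/(zvar R _) mulrBl divff ?zvar_neq0 // mulrA.
have -> : Num.max 0 (w b - w a) = Num.max (w a) (w b) - w a.
  by rewrite -(subrr (w a)) -addr_maxl.
apply: fdegM (fdegV (fdeg_zvar a)); apply: fdegP.
exact: deg_eq_binomial.
Qed.

Let X_neq0 : (tofrac 'X : K) != 0.
Proof. by rewrite tofrac_eq0 polyX_eq0. Qed.

Lemma fdeg_1Bh : fdeg w (1 - h) 0.
Proof.
have -> : 1 - h = tofrac (mpolyC n (tofrac (1 - 'X) : K)).
  by rewrite rmorphB rmorph1 tofrac_mpolyCB1.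
apply: fdegC; rewrite tofrac_eq0 subr_eq0 eq_sym; apply/eqP => E.
by have := size_polyX R[i]; rewrite E size_poly1.
Qed.

Lemma fdeg_1BhX m : fdeg w ((1 - h) ^+ m) 0.
Proof. by rewrite -[0](mulr0 m%:R); apply: fdegX; exact: fdeg_1Bh. Qed.

Lemma fdeg_1Bh_ratio a b : fdeg w (1 - h * (z b / z a)) (Num.max 0 (w b - w a)).
Proof.
have [->|ab] := eqVneq a b; last exact: fdeg_binomial.
by rewrite zvar_divff mulr1 (subrr (w b)) maxxx; exact: fdeg_1Bh.
Qed.

Lemma fdeg_1B_ratio a b : a != b ->
  fdeg w (1 - z b / z a) (Num.max 0 (w b - w a)).
Proof.
move=> ab; have := @fdeg_binomial 1 a b (oner_neq0 _) ab.
by rewrite mpoly.mpolyC1 rmorph1 mul1r.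
Qed.

(** For a = b the binomial is 0 and has no degree; only the upper bound survives. *)
Lemma fdeg_le_1B_ratio a b :
  fdeg_le w (1 - z b / z a) (Num.max 0 (w b - w a)).
Proof.
have [->|ab] := eqVneq a b; last exact: fdegW (lexx _) (fdeg_1B_ratio ab).
by rewrite zvar_divff subrr; exact: fdeg_le0.
Qed.

End DegreeOfRatios.

(** Having a degree in some direction, here 0, forces a fraction to be nonzero. *)
Lemma ratio_neq1 (R : realType) (n : nat) (a b : 'I_n) : a != b ->
  1 - zvar R b / zvar R a != 0.
Proof. by move=> ab; exact: fdeg_neq0 (fdeg_1B_ratio (fun=> 0) ab). Qed.


(** * Laurent polynomials and the weights of their exponents *)

Section LaurentPolynomials.
Variables (R : realType) (n : nat).
Notation K := (coef_field R).
Notation A := (mpoly n K).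
Notation Frac := (rat_field R n).
Notation malgZ := (malg 'rV[int]_n K).
Implicit Types (f g : Frac) (q : A) (p : malgZ) (w : 'I_n -> R).

Lemma laurent_evalD p1 p2 : laurent_eval (p1 + p2) = laurent_eval p1 +
  laurent_eval p2.
Proof.
have E p : laurent_eval p = monalg.mmap (@tofrac A \o @mpolyC n K)
    (fun e : 'rV[int]_n => \prod_(a < n) zvar R a ^ e ord0 a) p by [].
by rewrite !E raddfD.
Qed.

Lemma laurent_eval0 : laurent_eval (0 : malgZ) = 0.
Proof. by rewrite /laurent_eval monalg.msupp0 big_seq_fset0. Qed.

Lemma laurent_evalU (e : 'rV[int]_n) (c : K) :
  laurent_eval (mkmalgU e c) =
  tofrac (mpolyC n c) * \prod_(a < n) zvar R a ^ e ord0 a.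
Proof.
rewrite /laurent_eval monalg.msuppU; case: eqP => [->|_].
  by rewrite big_seq_fset0 mpolyC0 rmorph0 mul0r.
by rewrite big_seq_fset1 mcoeffUU.
Qed.

Let Z : Frac := \prod_(a < n) zvar R a.

Let Z_neq0 : Z != 0.
Proof. by apply/prodf_neq0 => a _; exact: zvar_neq0. Qed.

(** Asking for a power of z_1 ... z_n as denominator makes closure under sums and products direct;
    [laurentP] relates it to Laurent expansions. *)
Definition laurent f := exists k q, f * Z ^+ k = tofrac q.

Lemma laurent_polynomial q : laurent (tofrac q).
Proof. by exists 0%N, q; rewrite expr0 mulr1. Qed.

Lemma laurentM f g : laurent f -> laurent g -> laurent (f * g).
Proof.
move=> [k [q fq]] [l [r gr]]; exists (k + l)%N, (q * r).
by rewrite exprD mulrACA fq gr rmorphM.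
Qed.

Let tofracZ k : exists q, Z ^+ k = tofrac q.
Proof. by exists ((\prod_(a < n) mpolyX K (mnm1 a)) ^+ k);
  rewrite rmorphXn rmorph_prod. Qed.

Lemma laurentD f g : laurent f -> laurent g -> laurent (f + g).
Proof.
move=> [k [q fq]] [l [r gr]]; have [zk zkE] := tofracZ k;
  have [zl zlE] := tofracZ l.
exists (k + l)%N, (q * zl + r * zk).
by rewrite rmorphD !rmorphM /= -zkE -zlE -fq -gr exprD; ring.
Qed.

Lemma laurent1 : laurent 1.
Proof. by rewrite -(rmorph1 (@tofrac A)); exact: laurent_polynomial. Qed.

Lemma laurent_prod (T : Type) (r : seq T) (P : pred T) (F : T -> Frac) :
  (forall i, P i -> laurent (F i)) -> laurent (\prod_(i <- r | P i) F i).
Proof. by move=> FL; elim/big_ind: _ => //;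
  [exact: laurent1|exact: laurentM]. Qed.

Lemma laurent_zvar a : laurent (zvar R a).
Proof. exact: laurent_polynomial. Qed.

Lemma laurent_zvarV a : laurent (zvar R a)^-1.
Proof.
exists 1%N, (\prod_(b < n | b != a) mpolyX K (mnm1 b)).
by rewrite expr1 /Z (bigD1 a) //= mulKf ?zvar_neq0 // rmorph_prod.
Qed.

Lemma laurent_ratio a b : laurent (zvar R b / zvar R a).
Proof. exact: laurentM (laurent_zvar _) (laurent_zvarV _). Qed.

Lemma laurent_zvarXz a (k : int) : laurent (zvar R a ^ k).
Proof.
have LX f m : laurent f -> laurent (f ^+ m).
  by move=> fL; elim: m => [|m IH]; [exact: laurent1|rewrite exprS;
    exact: laurentM].
case: k => k; first exact/LX/laurent_zvar.
by rewrite NegzE -exprnN -exprVn; exact/LX/laurent_zvarV.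
Qed.

Lemma laurent_laurent_eval p : laurent (laurent_eval p).
Proof.
rewrite /laurent_eval; apply: big_ind => [||e _].
- by rewrite -(rmorph0 (@tofrac A)); exact: laurent_polynomial.
- exact: laurentD.
- apply: laurentM; first exact: laurent_polynomial.
  by apply: laurent_prod => a _; exact: laurent_zvarXz.
Qed.

Definition unshift_mnm (k : nat) (m : multinom n) : 'rV[int]_n :=
  \row_a ((m a)%:Z - k%:Z).

(** The Laurent expansion of q / (z_1 ... z_n)^k. *)
Definition unshift k q : malgZ :=
  \sum_(m <- mpoly.msupp q) mkmalgU (unshift_mnm k m) (mpoly.mcoeff m q).

Lemma unshift_mnm_inj k : injective (unshift_mnm k).
Proof.
move=> m1 m2 /rowP E; apply/mnmP => a.
by have := E a; rewrite !mxE => /addIr[].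
Qed.

Lemma mcoeff_unshift k q m :
  monalg.mcoeff (unshift_mnm k m) (unshift k q) = mpoly.mcoeff m q.
Proof.
rewrite /unshift raddf_sum /=.
under eq_bigr do rewrite mcoeffU (inj_eq (@unshift_mnm_inj k)).
have [mq|mq] := boolP (m \in mpoly.msupp q).
  rewrite (bigD1_seq m) ?mpoly.msupp_uniq //= eqxx big1 ?addr0 //.
  by move=> m' /negPf ->.
rewrite (memN_msupp_eq0 mq) big1_seq // => m' /andP[_ m'q].
by have [E|_] := eqVneq m' m; [rewrite -E m'q in mq|rewrite mulr0n].
Qed.

Lemma msupp_unshift k q e : e \in monalg.msupp (unshift k q) ->
  exists m, e = unshift_mnm k m.
Proof.
rewrite -mcoeff_neq0 /unshift raddf_sum /= => sum0.
have [m _ E] : exists2 m, m \in mpoly.msupp q & unshift_mnm k m == e.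
  apply/hasP; apply: contraNT sum0 => /hasPn noe; apply/eqP.
  by rewrite big1_seq // => m /andP[_ /noe/negPf]; rewrite mcoeffU => ->.
by exists m; rewrite (eqP E).
Qed.

Lemma laurent_eval_unshift k q : laurent_eval (unshift k q) * Z ^+ k = tofrac q.
Proof.
rewrite [in RHS](mpolyE q) rmorph_sum /= /unshift.
rewrite (big_morph _ laurent_evalD laurent_eval0) mulr_suml.
apply: eq_bigr => m _; rewrite laurent_evalU -mulrA -mul_mpolyC rmorphM /=.
congr (_ * _); rewrite mpolyXE_id rmorph_prod /= /Z -prodrXl -big_split.
apply: eq_bigr => a _; rewrite mxE /= rmorphXn -/(zvar R a) !exprnP.
by rewrite -expfzDr ?zvar_neq0 // subrK.
Qed.

Lemma laurentP f : laurent f <-> exists p, laurent_eval p = f.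
Proof.
split=> [[k [q fq]]|[p <-]]; last exact: laurent_laurent_eval.
exists (unshift k q); apply: (mulIf (expf_neq0 k Z_neq0)).
by rewrite laurent_eval_unshift.
Qed.

Lemma laurent_eval_laurent_of f : laurent f -> laurent_eval (laurent_of f) = f.
Proof.
move=> /laurentP[p pf].
by apply: (@xgetPex _ 0 [set p | laurent_eval p = f]); exists p.
Qed.

Lemma laurent_of_out f : ~ laurent f -> laurent_of f = 0.
Proof. by move=> fN; apply: xgetPN => p pf; apply: fN; apply/laurentP;
  exists p. Qed.

Definition wtz w (e : 'rV[int]_n) : R := \sum_a w a * (e ord0 a)%:~R.

Let wtz_unshift w k m : wtz w (unshift_mnm k m) = wt w m - k%:R * \sum_a w a.
Proof.
rewrite /wt mulr_sumr -sumrB; apply: eq_bigr => a _.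
by rewrite mxE rmorphB /= mulrBr [k%:R * _]mulrC.
Qed.

Let fdegZ w k : fdeg w (Z ^+ k) (k%:R * \sum_a w a).
Proof. by apply: fdegX; apply: fdeg_prod => a _; exact: fdeg_zvar. Qed.

(** By uniqueness of expansions [p] is [unshift k q], so its exponents are translates of those of
    the polynomial [q]. This carries the degree results over from polynomials. *)
Let laurent_eval_msupp p : exists k q,
  [/\ laurent_eval p * Z ^+ k = tofrac q,
    forall e, e \in monalg.msupp p ->
      exists2 m, m \in mpoly.msupp q & e = unshift_mnm k m &
    forall m, m \in mpoly.msupp q -> unshift_mnm k m \in monalg.msupp p].
Proof.
have [k [q pq]] := laurent_laurent_eval p; exists k, q.
have -> : p = unshift k q.
  apply: laurent_eval_inj; apply: (mulIf (expf_neq0 k Z_neq0)).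
  by rewrite laurent_eval_unshift.
split=> [|e|m]; first exact: laurent_eval_unshift.
- move=> ep; have [m E] := msupp_unshift ep; exists m => //.
  by rewrite mcoeff_msupp -(mcoeff_unshift k) -E mcoeff_neq0.
- by rewrite mcoeff_msupp -(mcoeff_unshift k) mcoeff_neq0.
Qed.

Lemma fdeg_le_laurent w p d e :
  fdeg_le w (laurent_eval p) d -> e \in monalg.msupp p -> wtz w e <= d.
Proof.
have [k [q [pq supp _]]] := laurent_eval_msupp p.
move=> pd /supp[m mq ->]; rewrite wtz_unshift lerBlDr.
have := fdeg_leM pd (fdegW (lexx _) (fdegZ w k)); rewrite pq.
by move=> qd; exact: fdeg_le_polynomial qd mq.
Qed.

Lemma fdeg_laurent w p d : fdeg w (laurent_eval p) d ->
  exists2 e, e \in monalg.msupp p & d = wtz w e.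
Proof.
have [k [q [pq _ supp]]] := laurent_eval_msupp p.
move=> pd; have := fdegM pd (fdegZ w k);
  rewrite pq => /fdeg_polynomial[m mq mE].
exists (unshift_mnm k m); first exact: supp.
by rewrite wtz_unshift mE addrK.
Qed.

(** Translation of exponents is injective, so no two terms merge or cancel. *)
Lemma msupp_mul_monomial (s : 'rV[R]_n) p (x : 'rV[R]_n) :
  reflect (exists2 e, e \in monalg.msupp p & x = map_mx intr e + s)
    (x \in monalg.msupp (mul_monomial s p)).
Proof.
have inj : injective (fun e : 'rV[int]_n => map_mx intr e + s : 'rV[R]_n).
  move=> e1 e2 /addIr/rowP E; apply/rowP => a.
  by have := E a; rewrite !mxE => /intr_inj.
rewrite -mcoeff_neq0 /mul_monomial raddf_sum /=.
under eq_bigr do rewrite mcoeffU.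
apply: (iffP idP) => [sum0|[e ep ->]].
  have [e ep E] : exists2 e, e \in (monalg.msupp p : seq _) &
      map_mx intr e + s == x.
    apply/hasP; apply: contraNT sum0 => /hasPn noe; apply/eqP.
    by rewrite big1_seq // => e /andP[_ /noe/negPf ->].
  by exists e => //; rewrite (eqP E).
rewrite (bigD1_seq e) ?fset_uniq //= eqxx big1 ?addr0 ?mcoeff_neq0 //.
by move=> e' e'e; rewrite (inj_eq inj) (negPf e'e).
Qed.

Lemma dot_map_mx w (e : 'rV[int]_n) (s : 'rV[R]_n) :
  dot w (map_mx intr e + s) = wtz w e + dot w s.
Proof.
by rewrite dotD; congr (_ + _); apply: eq_bigr => a _; rewrite mxE.
Qed.

End LaurentPolynomials.

(** * Iterated symmetrizations as sums over families of permutations *)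

Section Symmetrization.
Variables (n N : nat) (lam : 'I_N -> nat) (F : fieldType).
Implicit Types (f : (nat -> 'I_n -> F) -> F) (t : nat -> 'I_n -> F).
Implicit Types (l : seq nat) (s : nat -> {perm 'I_n}).

(** These families, one permutation per level, index the summands of the symmetrizations over the
    levels in [l]. *)
Definition level_perms l s :=
  (forall k, perm_on [set a : 'I_n | (a < lamsum lam k)%N]%SET (s k)) /\
  (forall k, k \notin l -> s k = 1%g).

Lemma level_perms_cons t k l (s : {perm 'I_n}) s' :
  perm_on [set a : 'I_n | (a < lamsum lam k)%N]%SET s -> level_perms l s' ->
  let s'' j := if j == k then (s' j * s)%g else s' j in
  level_perms (k :: l) s'' /\
  (fun j a => (if j == k then t k \o s else t j) (s' j a)) =
    (fun j a => t j (s'' j a)).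
Proof.
move=> son [s'on s'1] s''; split.
  split=> j; first by rewrite /s''; case: eqP => [->|//]; apply: perm_onM.
  by rewrite inE negb_or /s'' => /andP[/negPf -> /s'1].
apply/funext => j; apply/funext => a; rewrite /s''.
by case: eqP => [->|//]; rewrite /= permM.
Qed.

(** Unfolding the sums leaves values of [f] at levelwise permuted arguments. It serves for [Q] a
    degree bound and for [Q] equality with 0. *)
Lemma foldr_Sym_ind (Q : F -> Prop) f l t :
  Q 0 -> (forall x y, Q x -> Q y -> Q (x + y)) ->
  (forall s, level_perms l s -> Q (f (fun k a => t k (s k a)))) ->
  Q (foldr (Sym_t lam (F := F)) f l t).
Proof.
move=> Q0 QD; elim: l t => [|k l IH] t Qf /=.
  have -> : t = (fun k a => t k ((1%g : {perm 'I_n}) a)).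
    by apply/funext => k; apply/funext => a; rewrite perm1.
  by apply: (Qf (fun=> 1%g)); split=> // k; exact: perm_on1.
apply: big_ind => // s sk; apply: IH => s' s'P.
have [lP ->] := level_perms_cons t sk s'P; exact: Qf.
Qed.

Lemma foldr_Sym_id f l t : uniq l ->
  (forall s, level_perms l s -> (exists k, s k != 1%g) ->
     f (fun k a => t k (s k a)) = 0) ->
  foldr (Sym_t lam (F := F)) f l t = f t.
Proof.
elim: l t => [|k l IH] //= t /andP[kl ul] f0.
rewrite {1}/Sym_t (bigD1 1%g) /=; last exact: perm_on1.
rewrite big1 ?addr0 => [|s /andP[son s1]].
  rewrite (_ : (fun _ => _) = t); last first.
    apply/funext => j; case: eqP => [->|//].
    by apply/funext => a; rewrite /= perm1.
  apply: IH => // s [son s1]; apply: f0; split=> // j.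
  by rewrite inE negb_or => /andP[_ /s1].
apply: (@foldr_Sym_ind (fun x => x = 0)) => [//|x y -> ->|s' s'P].
  by rewrite addr0.
have [lP ->] := level_perms_cons t son s'P; apply: f0 => //.
(* As [k] is not in [l], [s'] is trivial at [k], and the composite there is [s], which is not 1. *)
by exists k; rewrite eqxx (proj2 s'P) // mul1g.
Qed.

End Symmetrization.

(** Otherwise s b <= b for all b, and strong induction shows that [s] fixes every point: if s a < a,
    then s (s a) = s a, against injectivity. *)
Lemma perm_exists_gt (n : nat) (s : {perm 'I_n}) : s != 1%g ->
  exists a : 'I_n, (a < s a)%N.
Proof.
move=> s1; apply/existsP; apply: contraNT s1 => /existsPn sle.
have le_s b : (s b <= b)%N by rewrite leqNgt; exact: sle.
apply/eqP/permP => a; rewrite perm1.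
elim/ltn_ind: {a}(val a) {-2}a (erefl (val a)) => m IH a am.
apply/val_inj/eqP; rewrite eqn_leq le_s /= leqNgt; apply/negP => lt_sa.
have := IH _ _ (s a) (erefl _); rewrite -am => /(_ lt_sa)/perm_inj E.
by rewrite E ltnn in lt_sa.
Qed.

(** * Degrees of the summands of a weight function *)

Section WeightTerms.
Variables (R : realType) (n N : nat) (lam : 'I_N -> nat).
Variables (Delta : set 'rV[R]_N) (w : 'I_n -> R).
Notation K := (coef_field R).
Notation h := (hvar R n).
Notation z := (@zvar R n).
Implicit Types (I J : {ffun 'I_N -> {set 'I_n}}).

Section Terms.
Variables (j0 : 'I_N) (I J : {ffun 'I_N -> {set 'I_n}}).
Hypotheses (IP : I \in ordered_partitions n lam)
  (JP : J \in ordered_partitions n lam).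
Variable s : nat -> {perm 'I_n}.
Hypothesis sP : forall k, perm_on [set a : 'I_n | (a < lamsum lam k)%N]%SET (s
  k).

(** The map phi_k of the summand given by [s]: it sends i^(k)_a to j^(k)_b with b = s_k(a). *)
Definition perm_point k (x : 'I_n) : 'I_n := elt J k (s k (elt_rank lam I k x)).

Let t k a := z (elt J k (s k a)).

Let lt_s k (a : 'I_n) : (s k a < lamsum lam k)%N = (a < lamsum lam k)%N.
Proof. by have := perm_closed a (sP k); rewrite !inE. Qed.

Let point_elt k (a : 'I_n) : (a < lamsum lam k)%N ->
  perm_point k (elt I k a) = elt J k (s k a).
Proof. by move=> ak; rewrite /perm_point (elt_rankK IP). Qed.

Lemma sum_perm_point k (G : 'I_n -> R) :
  \sum_(x in union_upto I k) G (perm_point k x) = \sum_(x in union_upto J k) G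
    x.
Proof.
rewrite -(big_elt IP) -(big_elt JP) [RHS](reindex_inj (@perm_inj _ (s k))) /=.
by apply: eq_big => [a|a ak]; rewrite ?lt_s ?point_elt.
Qed.

Lemma fdeg_le_psi (k : 'I_N) (a c : 'I_n) :
  (a < lamsum lam k)%N -> (c < lamsum lam k.+1)%N ->
  fdeg_le w (psi Delta I h k a c (t k.+1 c / t k a))
    (psi_deg Delta j0 I w perm_point k (elt I k a) (elt I k.+1 c)).
Proof.
move=> ak ck; rewrite /psi /psi_deg !point_elt // /t.
(* [psi] and [psi_deg] use different default components, but every element lies in a block. *)
have -> : block_of I j0 (elt I k a) = block_of I k (elt I k a).
  by apply/eqP; rewrite -(block_ofP IP) (block_ofP IP k).
case: ltnP => [lt_ca|_].
  have /negPf -> : elt I k.+1 c != elt I k a by rewrite -val_eqE /= ltn_eqF.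
  exact: fdegW (lexx _) (fdeg_1Bh_ratio w _ _).
case: eqP => [E|_]; last exact: fdeg_le_1B_ratio.
by rewrite -E !point_elt //; apply: fdegW (lexx _) (fdegXz _ (fdeg_ratio _ _
  _)).
Qed.

(** Numerator and denominator have the same degree; the latter has one because a < b are sent to
    distinct points. *)
Lemma fdeg_denominators k (a : 'I_n) : (a < lamsum lam k)%N ->
  fdeg w (\prod_(b < n | (a < b < lamsum lam k)%N)
    ((1 - h * (t k b / t k a)) / (1 - t k b / t k a))) 0.
Proof.
move=> ak; have -> : 0 = \sum_(b < n | (a < b < lamsum lam k)%N) (0 : R).
  by rewrite big1.
apply: fdeg_prod => b /andP[ab bk].
have neq : elt J k (s k a) != elt J k (s k b).
  apply: contraTneq ab => /(elt_inj JP);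
    rewrite !lt_s => /(_ ak bk)/perm_inj ->.
  by rewrite ltnn.
rewrite -(subrr (Num.max 0 (w (elt J k (s k b)) - w (elt J k (s k a))))).
by apply: fdegM (fdegV _); [exact: fdeg_1Bh_ratio|exact: fdeg_1B_ratio].
Qed.

(** The [+ 0] is the degree of the ratios within a level, and level 0 contributes an empty sum. *)
Let sum_levels (D : 'I_N -> 'I_n -> 'I_n -> R) :
  \sum_(k < N | (0 < k)%N) \sum_(a < n | (a < lamsum lam k)%N)
    (\sum_(c < n | (c < lamsum lam k.+1)%N) D k (elt I k a) (elt I k.+1 c) + 0)
      =
  \sum_(k < N) \sum_(x in union_upto I k) \sum_(y in union_upto I k.+1) D k x y.
Proof.
rewrite big_mkcond; apply: eq_bigr => k _; case: posnP => [->|_].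
  by rewrite sum_union_upto0.
rewrite -(big_elt IP); apply: eq_bigr => a _.
by rewrite addr0 -(big_elt IP).
Qed.

Lemma fdeg_le_weight_term : fdeg_le w (weight_term lam Delta I h t)
  (\sum_(k < N) \sum_(x in union_upto I k) \sum_(y in union_upto I k.+1)
     psi_deg Delta j0 I w perm_point k x y).
Proof.
rewrite -sum_levels; apply: fdeg_le_prod => k _; apply: fdeg_le_prod => a ak.
apply: fdeg_leM; last exact: fdegW (lexx _) (fdeg_denominators ak).
by apply: fdeg_le_prod => c ck; exact: fdeg_le_psi.
Qed.

End Terms.

(** * The case I = J: exact degree, vanishing summands, Laurent property *)

Section Diagonal.
Variable J : {ffun 'I_N -> {set 'I_n}}.
Hypothesis JP : J \in ordered_partitions n lam.

Let t k a := z (elt J k a).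

(** The degree is exact here: equal indices give a power of 1, and the factors 1 - x occur only at
    distinct points. *)
Lemma fdeg_psi_diag (k : 'I_N) (a c : 'I_n) :
  fdeg w (psi Delta J h k a c (t k.+1 c / t k a))
    (Num.max 0 (w (elt J k.+1 c) - w (elt J k a))).
Proof.
rewrite /psi /t; case: ltnP => [_|_]; first exact: fdeg_1Bh_ratio.
case: eqP => [->|/eqP ca]; last by apply: fdeg_1B_ratio; rewrite eq_sym.
rewrite zvar_divff exp1rz (subrr (w _)) maxxx.
exact: fdeg1.
Qed.

Lemma fdeg_weight_term_diag : fdeg w (weight_term lam Delta J h t)
  (\sum_(k < N) \sum_(x in union_upto J k) \sum_(y in union_upto J k.+1)
     Num.max 0 (w y - w x)).
Proof.
have -> : \sum_(k < N) \sum_(x in union_upto J k) \sum_(y in union_upto J k.+1)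
    Num.max 0 (w y - w x) =
    \sum_(k < N | (0 < k)%N) \sum_(a < n | (a < lamsum lam k)%N)
     (\sum_(c < n | (c < lamsum lam k.+1)%N)
       Num.max 0 (w (elt J k.+1 c) - w (elt J k a)) + 0).
  rewrite [RHS]big_mkcond; apply: eq_bigr => k _; case: posnP => [->|_].
    by rewrite sum_union_upto0.
  rewrite -(big_elt JP); apply: eq_bigr => a _; rewrite addr0.
  by rewrite -(big_elt JP).
apply: fdeg_prod => k _; apply: fdeg_prod => a ak.
apply: fdegM; first by apply: fdeg_prod => c _; exact: fdeg_psi_diag.
have on1 k' : perm_on [set a : 'I_n | (a < lamsum lam k')%N]%SET 1%g.
  exact: perm_on1.
have := fdeg_denominators JP (s := fun=> 1%g) on1 ak.
by under eq_bigr do rewrite !perm1; apply.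
Qed.

(** Let k be the highest level with s_k <> 1, and let a < s_k(a). Since s_(k+1) = 1, the point put
    for t^(k)_a is also the one put for some t^(k+1)_c. Its index j^(k+1)_c exceeds j^(k)_a, so the
    factor 1 - x is taken at x = 1 and vanishes. *)
Lemma weight_term_diag_eq0 (s : nat -> {perm 'I_n}) :
  level_perms lam (iota 1 N.-1) s -> (exists k, s k != 1%g) ->
  weight_term lam Delta J h (fun k a => t k (s k a)) = 0.
Proof.
move=> [son s1] [k0 sk0].
have bounded k : s k != 1%g -> (0 < k < N)%N.
  move=> sk; have : k \in iota 1 N.-1 by apply: contraNT sk => /s1 ->.
  rewrite mem_iota add1n ltnS => /andP[k_gt0]; rewrite k_gt0 /=.
  by case: (N) => [|//] /=; rewrite leqNgt k_gt0.
have ex : exists k, s k != 1%g by exists k0.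
have ub k : s k != 1%g -> (k <= N)%N by move=> /bounded/andP[_ /ltnW].
case: (ex_maxnP ex ub) => k sk kmax.
have /andP[k_gt0 kN] := bounded _ sk.
have sk1 : s k.+1 = 1%g.
  by apply/eqP/negPn/negP => /kmax; rewrite ltnn.
have [a lt_a] := perm_exists_gt sk.
have ak : (a < lamsum lam k)%N.
  have /fintype.subsetP/(_ a) := son k; rewrite !inE; apply.
  by apply: contraTneq lt_a => ->; rewrite ltnn.
have sak : (s k a < lamsum lam k)%N.
  by have := perm_closed a (son k); rewrite !inE ak.
have in1 : elt J k (s k a) \in union_upto J k.+1.
  by apply: fintype.subsetP (elt_in JP sak); exact: sub_union_upto.
have [c ck cE] := elt_surj JP in1.
rewrite /weight_term (bigD1 (Ordinal kN)) //= (bigD1 a) //= (bigD1 c) //=.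
suff -> : psi Delta J h (Ordinal kN) a c (t k.+1 (s k.+1 c) / t k (s k a)) = 0.
  by rewrite !mul0r.
rewrite /psi /= cE /t sk1 perm1 cE zvar_divff.
have lt_elt : (elt J k a < elt J k (s k a))%N by rewrite (elt_mono JP).
rewrite ltnNge (ltnW lt_elt) /=.
have /negPf -> : elt J k (s k a) != elt J k a by rewrite -val_eqE gtn_eqF.
by rewrite subrr.
Qed.

Lemma laurent_1Bh_ratio a b : laurent (1 - h * (z b / z a)).
Proof.
have -> : 1 - h * (z b / z a) = 1 + tofrac (mpolyC n (- tofrac 'X)) * (z b / z
  a).
  by rewrite mpolyCN rmorphN mulNr.
apply: laurentD; first exact: laurent1.
by apply: laurentM; [exact: laurent_polynomial|exact: laurent_ratio].
Qed.

Lemma laurent_1B_ratio a b : laurent (1 - z b / z a).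
Proof.
have -> : 1 - z b / z a = 1 + tofrac (mpolyC n (- 1)) * (z b / z a).
  by rewrite mpolyCN mpoly.mpolyC1 rmorphN rmorph1 mulN1r.
apply: laurentD; first exact: laurent1.
by apply: laurentM; [exact: laurent_polynomial|exact: laurent_ratio].
Qed.

(* The factors 1 - z_y / z_x with y > x and y in J_1 u ... u J_k cancel the
   denominators. *)
Lemma laurent_weight_term_diag : laurent (weight_term lam Delta J h t).
Proof.
apply: laurent_prod => k _; apply: laurent_prod => a ak.
pose x := elt J k a.
(* The factor [psi] as a function of the point y; at y = x it is a power of 1. *)
pose G (y : 'I_n) : rat_field R n := if (y < x)%N then 1 - h * (z y / z x)
  else if y == x then 1 else 1 - z y / z x.
have -> : \prod_(c < n | (c < lamsum lam k.+1)%N)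
    psi Delta J h k a c (t k.+1 c / t k a) =
    \prod_(y in union_upto J k.+1) G y.
  rewrite -(big_elt JP); apply: eq_bigr => c _.
  rewrite /psi /G /t -/x; case: ifP => // _; case: eqP => // ->.
  by rewrite zvar_divff exp1rz.
have -> : \prod_(b < n | (a < b < lamsum lam k)%N)
    ((1 - h * (t k b / t k a)) / (1 - t k b / t k a)) =
    \prod_(y in union_upto J k | (x < y)%N)
      ((1 - h * (z y / z x)) / (1 - z y / z x)).
  rewrite [RHS]big_mkcondr -(big_elt JP) /= -big_mkcondr; apply: eq_bigl => b.
  by rewrite andbC; case: (ltnP b _) => //= bk; rewrite (elt_mono JP).
rewrite (bigID (fun y => (y \in union_upto J k) && (x < y)%N)) /=.
have -> : \prod_(y in union_upto J k.+1 | (y \in union_upto J k) && (x < y)%N) G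
  y =
    \prod_(y in union_upto J k | (x < y)%N) (1 - z y / z x).
  apply: eq_big => [y|y /andP[_ /andP[_ xy]]].
    case: (boolP (y \in union_upto J k)) => yk; last by rewrite andbF.
    by rewrite (fintype.subsetP (sub_union_upto _ _) _ yk).
  by rewrite /G ltnNge (ltnW xy) /= -val_eqE gtn_eqF.
rewrite mulrAC -big_split /=; apply: laurentM.
  apply: laurent_prod => y /andP[_ xy].
  have yx : x != y by rewrite -val_eqE ltn_eqF.
  by rewrite mulrC mulfVK ?ratio_neq1 //; exact: laurent_1Bh_ratio.
apply: laurent_prod => y _; rewrite /G; case: ifP => _;
  first exact: laurent_1Bh_ratio.
by case: ifP => _; [exact: laurent1|exact: laurent_1B_ratio].
Qed.

End Diagonal.

End WeightTerms.

(** * Degrees of the substituted weight functions *)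

Section WeightFunctions.
Variables (R : realType) (n N : nat) (lam : 'I_N -> nat).
Variables (Delta : set 'rV[R]_N) (nu : 'rV[R]_N) (j0 : 'I_N).
Hypotheses (alcD : alcove Delta) (Dnu : Delta nu).
Implicit Types (I J : {ffun 'I_N -> {set 'I_n}}) (w : 'I_n -> R).

Definition diag_deg J w : R :=
  \sum_(k < N) \sum_(x in union_upto J k) \sum_(y in union_upto J k.+1)
    Num.max 0 (w y - w x).

Lemma weight_atE I J : J \in ordered_partitions n lam ->
  weight_at lam Delta I J = (1 - hvar R n) ^+ lamtot lam *
    foldr (Sym_t lam (F := _)) (weight_term lam Delta I (hvar R n)) (iota 1
      N.-1)
      (fun k a => zvar R (elt J k a)).
Proof.
move=> JP.
have tE : (fun k => if k == N then @zvar R n else fun a => zvar R (elt J k a)) =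
    (fun k a => zvar R (elt J k a)).
  apply/funext => k; case: eqP => [->|//]; apply/funext => a.
  by rewrite (elt_topE JP).
by rewrite /weight_at /weight_fun tE.
Qed.

Lemma weight_at_diag J : J \in ordered_partitions n lam ->
  weight_at lam Delta J J = (1 - hvar R n) ^+ lamtot lam *
    weight_term lam Delta J (hvar R n) (fun k a => zvar R (elt J k a)).
Proof.
move=> JP; rewrite weight_atE //; congr (_ * _).
apply: foldr_Sym_id; first exact: iota_uniq.
by move=> s; exact: weight_term_diag_eq0.
Qed.

Lemma fdeg_weight_at_diag J w : J \in ordered_partitions n lam ->
  fdeg w (weight_at lam Delta J J) (diag_deg J w).
Proof.
move=> JP; rewrite weight_at_diag // -[diag_deg J w]add0r.
apply: fdegM; last exact: fdeg_weight_term_diag.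
exact: fdeg_1BhX.
Qed.

Lemma laurent_weight_at_diag J : J \in ordered_partitions n lam ->
  laurent (weight_at lam Delta J J).
Proof.
move=> JP; rewrite weight_at_diag //.
apply: laurentM; last exact: laurent_weight_term_diag.
rewrite -tofrac_mpolyCB1; elim: (lamtot lam) => [|m IH]; first exact: laurent1.
by rewrite exprS; apply: laurentM => //; exact: laurent_polynomial.
Qed.

Lemma fdeg_le_weight_at I J w :
  I \in ordered_partitions n lam -> J \in ordered_partitions n lam ->
  fdeg_le w (weight_at lam Delta I J)
    (diag_deg J w + dot w (S_exponent nu J) - dot w (S_exponent nu I)).
Proof.
move=> IP JP; set d := _ - dot w _; rewrite weight_atE // -(add0r d);
  apply: fdeg_leM.
  exact: fdegW (lexx _) (fdeg_1BhX _ _).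
apply: (@foldr_Sym_ind _ _ _ _ (fun f => fdeg_le w f d)).
- exact: fdeg_le0.
- by move=> f g; exact: fdeg_leD.
move=> s [son s1].
apply: (fdeg_leW _ (fdeg_le_weight_term Delta w j0 IP JP son)).
rewrite lerBrDr; apply: (sum_psi_deg_le j0 IP JP alcD Dnu).
  by move=> k G _; exact: sum_perm_point.
move=> x; rewrite /perm_point (elt_topE JP) // s1 ?perm1; last first.
  (* Level N is not symmetrized, so s_N = 1 and phi_N is the identity. *)
  by rewrite mem_iota; case: (N) j0 => [[]//|m] _; rewrite add1n ltnn andbF.
have xT : x \in union_upto I N by rewrite (union_uptoT IP) // inE.
have [a ak <-] := elt_surj IP xT.
by rewrite (elt_rankK IP) // (elt_topE IP).
Qed.

End WeightFunctions.

Theorem theorem3p9 (R : realType) (n N : nat) (lam : 'I_N -> nat)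
    (Delta : set 'rV[R]_N) (nu : 'rV[R]_N) (I J : {ffun 'I_N -> {set 'I_n}}) :
  (0 < n)%N -> (0 < N)%N -> (\sum_(k < N) lam k)%N = n ->
  alcove Delta -> Delta nu ->
  I \in ordered_partitions n lam -> J \in ordered_partitions n lam ->
  O_polytope lam Delta nu I J `<=` O_polytope lam Delta nu J J.
Proof.
move=> _ N_gt0 _ alcD Dnu IP JP; pose j0 := Ordinal N_gt0.
(* The right-hand side is convex, so it is enough that it contains each exponent. *)
apply: smallest_sub; first exact: convex_hull_convex.
move=> x /msupp_mul_monomial[e eI ->].
have WE : laurent_eval (laurent_of (weight_at lam Delta I J)) =
    weight_at lam Delta I J.
  (* Without a Laurent expansion [laurent_of] takes its default value 0, which has no exponent
     [e]. *)
  have [WL|/laurent_of_out W0] := pselect (laurent (weight_at lam Delta I J)).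
    exact: laurent_eval_laurent_of.
  by rewrite W0 monalg.msupp0 inE in eI.
apply: convex_hull_support => w.
have := fdeg_weight_at_diag Delta w JP.
rewrite -(laurent_eval_laurent_of (laurent_weight_at_diag Delta JP)).
move=> /fdeg_laurent[e' e'J dE].
(* [e'] is an exponent at which the degree of W_J(z_J) in direction [w] is attained. *)
exists (map_mx intr e' + S_exponent nu J).
  by apply/msupp_mul_monomial; exists e'.
rewrite !dot_map_mx -dE -lerBrDr; apply: (fdeg_le_laurent _ eI).
by rewrite WE; exact: fdeg_le_weight_at.
Qed.
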